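(* Let $q$ be a power of an odd prime $p$, let $M\geq2$ be an integer written as $M=t\cdot p^r$ with $p\nmid t$, $r\ge0$, and for $n\ge1$ let $a_n=\#\{x\in\mathrm{GL}_n(\mathbb{F}_q): x^M=\mathrm{Id}_n\}$. Then, as formal power series in $z$, $$1+\sum_{n=1}^{\infty}\frac{a_n}{|\mathrm{GL}_n(\mathbb{F}_q)|}z^n=\prod_{d\mid t}\left(1+\sum_{m\geq1}\ \sum_{\substack{\lambda\vdash m\\ \lambda_1\leq p^r}}\frac{z^{m\,e(d)}}{q^{e(d)\sum_i(\lambda_i')^2}\prod_{i\geq1}\prod_{j=1}^{m_i(\lambda)}\bigl(1-q^{-e(d)j}\bigr)}\right)^{\phi(d)/e(d)}.$$
   Context: $\phi$ is Euler's totient function; for a positive integer $d$ coprime to $q$, $e(d)$ is the multiplicative order of $q$ in $(\mathbb{Z}/d\mathbb{Z})^\times$ ($e(1)=1$). For a partition $\lambda$, $\lambda_1$ is its largest part, $\lambda'$ is its transpose (conjugate) partition with parts $\lambda'_1\ge\lambda'_2\ge\cdots$, and $m_i(\lambda)$ is the number of parts of $\lambda$ equal to $i$; an empty inner product equals $1$. *)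

(* Defs.v *)
From HB Require Import structures.
From mathcomp Require Import all_boot all_order all_algebra all_fingroup all_field.
Set Implicit Arguments. Unset Strict Implicit. Unset Printing Implicit Defensive.
Import Order.TTheory GRing.Theory Num.Theory.
Local Open Scope ring_scope.

Definition ps := nat -> rat.
Definition ps_one : ps := fun n => if n == 0%N then 1 else 0.
Definition ps_mul (f g : ps) : ps :=
  fun n => \sum_(i < n.+1) f i * g (n - i)%N.
Definition ps_pow (f : ps) (k : nat) : ps := iter k (ps_mul f) ps_one.
Definition ps_prod (s : seq ps) : ps := foldr ps_mul ps_one s.

(* smallest k >= 1 with q^k = 1 (mod d); for such d it is <= d; e(1) = 1 *)
Definition mord (q d : nat) : nat :=
  head 0%N [seq k <- iota 1 d | q ^ k == 1 %[mod d]].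

(* A partition of m is encoded by its parts listed in nonincreasing order and
   padded with zeros to length m (every partition of m has at most m parts). *)
Definition is_partition_code (m : nat) (f : {ffun 'I_m -> 'I_m.+1}) : bool :=
  [forall i : 'I_m, forall j : 'I_m, (i <= j)%N ==> (f j <= f i)%N]
  && (\sum_(i < m) (f i : nat) == m)%N.

Definition parts (m : nat) (f : {ffun 'I_m -> 'I_m.+1}) : seq nat :=
  [seq x <- [seq (f i : nat) | i <- enum 'I_m] | (0 < x)%N].

Definition lam1 (l : seq nat) : nat := head 0%N l.
Definition conjp (l : seq nat) (j : nat) : nat := count (fun x => j <= x)%N l.
Definition multp (l : seq nat) (i : nat) : nat := count (pred1 i) l.

Definition part_term (q e : nat) (l : seq nat) : rat :=
  let Q : rat := q%:R in
  (Q ^+ (e * \sum_(1 <= i < (sumn l).+1) (conjp l i) ^ 2)%N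
   * \prod_(1 <= i < (sumn l).+1) \prod_(1 <= j < (multp l i).+1)
        (1 - (Q ^+ (e * j)%N)^-1))^-1.

Definition factor_ps (q e bound : nat) : ps := fun N =>
  if N == 0%N then 1
  else if (e %| N)%N then
    let m := (N %/ e)%N in
    \sum_(f : {ffun 'I_m -> 'I_m.+1} |
           is_partition_code f && (lam1 (parts f) <= bound)%N)
       part_term q e (parts f)
  else 0.

Definition GLcard (F : finFieldType) (n : nat) : nat :=
  #|[set A : 'M[F]_n | A \in unitmx]|.
Definition a_count (F : finFieldType) (M n : nat) : nat :=
  #|[set A : 'M[F]_n | (A \in unitmx) && (A ^+ M == 1)]|.

Definition lhs_ps (F : finFieldType) (M : nat) : ps := fun n =>
  if n == 0%N then 1 else (a_count F M n)%:R / (GLcard F n)%:R.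

Definition rhs_ps (q t bound : nat) : ps :=
  ps_prod [seq ps_pow (factor_ps q (mord q d) bound) (totient d %/ mord q d)
          | d <- divisors t].

(* Main.v *)
Require Import Defs.
From HB Require Import structures.
From mathcomp Require Import all_boot all_order all_algebra all_fingroup all_field.
From mathcomp Require Import cyclic qpoly qfpoly ring zify.
Set Implicit Arguments. Unset Strict Implicit. Unset Printing Implicit Defensive.
Import Order.TTheory GRing.Theory Num.Theory VectorInternalTheory.
Local Open Scope ring_scope.

(** For a polynomial f over F, let Z(f) be the series with coefficients
    #{A in M_n(F) | f(A) = 0} / |GL_n(F)|.  Since X^M - 1 = (X^t - 1)^(p^r), the
    left-hand side is Z((X^t - 1)^(p^r)).

    Z is multiplicative on coprime polynomials, because F^n splits canonically
    as ker f(A) + ker g(A).  As X^t - 1 is separable and each cyclotomic factor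
    Phi_d is over F a product of totient(d)/e(d) irreducibles of degree e(d), only
    Z(phi^s) for phi irreducible of degree e is needed.  With K = F[X]/(phi) and
    x the class of X, every A killed by phi^s is conjugate to the restriction of
    scalars of some x + N with N in M_m(K), N^s = 0 and n = m e; moreover N is
    unique up to GL_m(K)-conjugacy, because x = (x + N)^(|K|^j) for large j.
    Hence Z(phi^s) counts nilpotent matrices over K.  These are classified by
    restricting N to its image: if a is the corank of N and c that of the
    restriction, the normalized counts satisfy the recurrence
    g(s+1, a, m) = |K|^(-a^2) sum_(c <= a) g(s, c, m-a) / (1/|K|; 1/|K|)_(a-c),
    which is also what removing the first column of a partition with a parts
    gives for the right-hand side.

    Each count follows the same pattern: every matrix of interest is conjugate to
    a normal form, and the invertible matrices carrying one normal form to another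
    make up a group that does not depend on the two forms. *)

Lemma partition_big_leq (R : Type) (idx : R) (op : Monoid.com_law idx)
    (I : Type) (r : seq I) (P : pred I) (f : I -> nat) n (F : I -> R) :
  (forall i, P i -> (f i <= n)%N) ->
  \big[op/idx]_(i <- r | P i) F i =
  \big[op/idx]_(j < n.+1) \big[op/idx]_(i <- r | P i && (f i == j)) F i.
Proof.
move=> f_le; rewrite (partition_big (fun i => inord (f i) : 'I_n.+1) xpredT) //.
apply: eq_bigr => j _; apply: eq_bigl => i.
by case Pi: (P i) => //=; rewrite -val_eqE /= inordK // ltnS f_le.
Qed.

Arguments partition_big_leq {R idx op I r P} f n {F}.

(** * Matrices *)

Lemma eq_mulrV (R : pzSemiRingType) m n (A B : 'M[R]_(m, n)) :
  (forall w : 'rV_m, w *m A = w *m B) -> A = B.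
Proof. by move=> AB; apply/row_matrixP => i; rewrite !rowE. Qed.

Lemma mul_rV_lin1_fun (R : pzRingType) m n (f : 'rV[R]_m -> 'rV[R]_n) :
  linear f -> forall u, u *m lin1_mx f = f u.
Proof.
move=> f_lin u; pose fL : {linear 'rV[R]_m -> 'rV[R]_n} :=
  HB.pack f (GRing.isLinear.Build _ _ _ _ f f_lin).
exact: (mul_rV_lin1 fL u).
Qed.

Lemma mulmx_exprS (R : pzRingType) m n (X : 'M[R]_(m, n)) (Y : 'M_(n, m)) s :
  (X *m Y) ^+ s.+1 = X *m (Y *m X) ^+ s *m Y.
Proof.
elim: s => [|s IH]; first by rewrite expr1 expr0 mulmx1.
by rewrite exprS IH exprS -!mulmxE !mulmxA.
Qed.

Lemma mulmx_full_eq0 (F : fieldType) m n p (A : 'M[F]_(m, n)) (B : 'M_(n, p)) :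
  row_full A -> (A *m B == 0) = (B == 0).
Proof.
move=> fullA; apply/eqP/eqP => [|->]; rewrite ?mulmx0 // -[RHS](mulmx0 _ A).
exact: row_full_inj.
Qed.

Lemma row_free_eqmx (F : fieldType) m n (A : 'M[F]_(m, n)) r :
  \rank A = r -> exists2 V : 'M[F]_(r, n), row_free V & (V :=: A)%MS.
Proof.
by move=> <-; exists (row_base A); [apply: row_base_free | apply: eq_row_base].
Qed.

Lemma row_free_usubmx (F : fieldType) c d (P : 'M[F]_(c + d)) :
  P \in unitmx -> row_free (usubmx P).
Proof.
move=> Pu; apply/row_freeP; exists (invmx P *m col_mx 1%:M 0).
by rewrite mulmxA mul_usub_mx mulmxV // mul_usub_mx mul1mx col_mxKu.
Qed.

Lemma unitmx_block_lower (R : comUnitRingType) m n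
    (A : 'M[R]_m) (B : 'M_n) (C : 'M_(n, m)) :
  (block_mx A 0 C B \in unitmx) = (A \in unitmx) && (B \in unitmx).
Proof. by rewrite !unitmxE det_lblock unitrM. Qed.

Lemma row_full_col_mx_ebase (F : fieldType) m l j c
    (B : 'M[F]_(m, j + c)) (C1 : 'M_(l, j)) (C2 : 'M_(l, c)) :
  \rank B = j ->
  row_full (col_mx B (row_mx C1 C2 *m row_ebase B)) = row_full C2.
Proof.
move=> rkB; pose I : 'M[F]_(j, j + c) := row_mx 1%:M 0.
have eqB : (B :=: I *m row_ebase B)%MS.
  have le_jm : (j <= m)%N by rewrite -rkB rank_leq_row.
  have sB : (B <= I *m row_ebase B)%MS.
    rewrite -{1}[B]mulmx_ebase rkB submxMr // /I -pid_mx_row.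
    have <- : (pid_mx j : 'M_(m, j)) *m pid_mx j = (pid_mx j : 'M[F]_(m, j + c)).
      by rewrite mul_pid_mx !minnn.
    by rewrite mulmxA submxMl.
  apply/eqmxP; rewrite -(mxrank_leqif_eq sB) rkB mxrankMfree ?rank_row_mx0 ?mxrank1 //.
  by rewrite row_free_unit row_ebase_unit.
rewrite /row_full -addsmxE (adds_eqmx eqB (eqmx_refl _)) addsmxE -mul_col_mx.
rewrite mxrankMfree ?row_free_unit ?row_ebase_unit //.
rewrite -[col_mx _ _]/(block_mx 1%:M 0 C1 C2).
have -> : block_mx (1%:M : 'M[F]_j) 0 C1 C2 =
    block_mx 1%:M 0 C1 1%:M *m block_mx 1%:M 0 0 C2.
  by rewrite mulmx_block !(mulmx1, mul1mx, mulmx0, mul0mx, addr0, add0r).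
rewrite eqmxMfull ?rank_diag_block_mx ?mxrank1 ?eqn_add2l //.
by rewrite row_full_unit unitmx_block_lower !unitmx1.
Qed.

Lemma conjmx_eqP (F : fieldType) n (P A B : 'M[F]_n) :
  P \in unitmx -> reflect (P *m A = B *m P) (conjmx P A == B).
Proof. exact: similarP. Qed.

Lemma mxrank_conjmx (F : fieldType) n (P A : 'M[F]_n) :
  P \in unitmx -> \rank (conjmx P A) = \rank A.
Proof.
move=> Pu; rewrite conjumx // mxrankMfree ?row_free_unit ?unitmx_inv //.
by rewrite eqmxMfull ?row_full_unit.
Qed.

Definition GLset (F : finFieldType) n := [set P : 'M[F]_n | P \in unitmx].

(* Each element of [Y] is conjugated into [X] by exactly one coset of [H]. *)
Lemma card_similarity_closure (F : finFieldType) n (X Y H : {set 'M[F]_n}) :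
  (forall A, A \in Y <-> exists2 P, P \in unitmx & conjmx P A \in X) ->
  {subset H <= unitmx} ->
  (forall P A, P \in unitmx -> A \in X -> (conjmx P A \in X) = (P \in H)) ->
  (#|Y| * #|H| = GLcard F n * #|X|)%N.
Proof.
move=> YP H_unit HP; pose good (P A : 'M[F]_n) := conjmx P A \in X.
have fibreP P : P \in GLset F n -> (\sum_(A | good P A) 1 = #|X|)%N.
  rewrite inE => Pu; rewrite -(@on_card_preimset _ _ (conjmx P)) ?sum1_card.
    by apply: eq_card => A; rewrite inE.
  by exists (conjmx (invmx P)) => A _; rewrite ?conjmxK ?conjmxVK.
have fibreA A : A \in Y -> (\sum_(P in GLset F n | good P A) 1 = #|H|)%N.
  case/YP=> P0 P0u P0A; rewrite sum1_card.
  rewrite -(card_imset (mem H) (can_inj (mulmxK P0u))); apply: eq_card => P.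
  rewrite unfold_in; apply/andP/imsetP => [[]|[T TH ->]]; rewrite ?inE.
    move=> Pu PA; exists (P *m invmx P0); last by rewrite mulmxKV.
    rewrite -(HP _ _ _ P0A) ?unitmx_mul ?Pu ?unitmx_inv //.
    by rewrite -conjuMumx ?mulmxKV // unitmx_mul Pu unitmx_inv.
  have Tu := H_unit T TH; rewrite unitmx_mul Tu P0u; split=> //.
  by rewrite /good conjuMumx // HP.
rewrite -[GLcard F n]/#|GLset F n| -!sum_nat_const.
rewrite -(eq_bigr _ fibreA) -(eq_bigr _ fibreP).
rewrite [RHS](exchange_big_dep [in Y]) //= => P A; rewrite inE => Pu PA.
by apply/YP; exists P.
Qed.

(** * Polynomials in a matrix *)

Section PolynomialInMatrix.
Variable F : fieldType.

(* [horner_mx] is only defined in positive dimension. *)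
Definition mxeval (n : nat) : 'M[F]_n -> {poly F} -> 'M[F]_n :=
  match n with
  | 0 => fun _ _ => 0
  | n'.+1 => fun A f => horner_mx A f
  end.

Lemma mxeval_is_zmod_morphism n (A : 'M[F]_n) : zmod_morphism (mxeval A).
Proof. by case: n A => [|n] A f g; rewrite /= ?subrr ?rmorphB. Qed.

Lemma mxeval_is_monoid_morphism n (A : 'M[F]_n) : monoid_morphism (mxeval A).
Proof.
by case: n A => [|n] A; split=> [|f g] //=;
  rewrite ?flatmx0 ?(flatmx0 (1 : 'M_0)) ?mulr0 ?rmorph1 ?rmorphM.
Qed.

HB.instance Definition _ n (A : 'M[F]_n) :=
  GRing.isZmodMorphism.Build {poly F} 'M[F]_n (mxeval A)
    (mxeval_is_zmod_morphism A).
HB.instance Definition _ n (A : 'M[F]_n) :=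
  GRing.isMonoidMorphism.Build {poly F} 'M[F]_n (mxeval A)
    (mxeval_is_monoid_morphism A).

Lemma mxevalX n (A : 'M[F]_n) : mxeval A 'X = A.
Proof. by case: n A => [|n] A /=; [rewrite [A]flatmx0|rewrite horner_mx_X]. Qed.

Lemma mxevalC n (A : 'M[F]_n) c : mxeval A c%:P = c%:M.
Proof. by case: n A => [|n] A /=; [rewrite [RHS]flatmx0|rewrite horner_mx_C]. Qed.

Lemma mxevalXn n (A : 'M[F]_n) s : mxeval A 'X^s = A ^+ s.
Proof. by rewrite rmorphXn /= mxevalX. Qed.

Lemma mxeval_intertwine m n (P : 'M[F]_(m, n)) (A : 'M_n) (B : 'M_m) f :
  P *m A = B *m P -> P *m mxeval A f = mxeval B f *m P.
Proof.
move=> PA; elim/poly_ind: f => [|f c IH]; first by rewrite !rmorph0 mulmx0 mul0mx.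
rewrite !rmorphD !rmorphM /= !mxevalX !mxevalC -!mulmxE mulmxDr mulmxDl.
by rewrite mulmxA IH -!mulmxA PA mul_mx_scalar mul_scalar_mx.
Qed.

Lemma mxeval_conjmx n (P A : 'M[F]_n) f :
  P \in unitmx -> mxeval (conjmx P A) f = conjmx P (mxeval A f).
Proof.
move=> Pu; apply/esym/eqP/conjmx_eqP => //; apply: mxeval_intertwine.
exact/conjmx_eqP.
Qed.

Lemma mxeval_block_diag m n (A : 'M[F]_m) (B : 'M_n) f :
  mxeval (block_mx A 0 0 B) f = block_mx (mxeval A f) 0 0 (mxeval B f).
Proof.
elim/poly_ind: f => [|f c IH]; first by rewrite !rmorph0 block_mx0.
rewrite !rmorphD !rmorphM /= !mxevalX !mxevalC IH -!mulmxE mulmx_block.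
by rewrite !(mul0mx, mulmx0, addr0, add0r) scalar_mx_block add_block_mx !addr0.
Qed.

Lemma mxeval_comp n (A : 'M[F]_n) f g :
  mxeval A (f \Po g) = mxeval (mxeval A g) f.
Proof.
elim/poly_ind: f => [|f c IH]; first by rewrite comp_poly0 !rmorph0.
by rewrite comp_poly_MXaddC !rmorphD !rmorphM /= IH mxevalX !mxevalC.
Qed.

Lemma coprimep_mxeval_unit n (A : 'M[F]_n) f g :
  coprimep f g -> mxeval A f = 0 -> mxeval A g \in unitmx.
Proof.
case/Bezout_eq1_coprimepP => -[u v] /= /(congr1 (mxeval A)) + fA0.
rewrite rmorphD !rmorphM rmorph1 /= fA0 mulr0 add0r -mulmxE.
by case/mulmx1_unit.
Qed.

Lemma coprimep_intertwine_eq0 m n (P : 'M[F]_(m, n)) (A : 'M_n) (B : 'M_m) f g :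
    coprimep f g -> mxeval A f = 0 -> mxeval B g = 0 ->
  P *m A = B *m P -> P = 0.
Proof.
move=> cop fA gB /(mxeval_intertwine g); rewrite gB mul0mx => /eqP.
have gAu := coprimep_mxeval_unit cop fA.
by rewrite mulmx_free_eq0 ?row_free_unit // => /eqP.
Qed.

Lemma adds_kermx_mxeval n (A : 'M[F]_n) f g :
    coprimep f g -> mxeval A (f * g) = 0 ->
  (kermx (mxeval A f) + kermx (mxeval A g) :=: 1%:M)%MS.
Proof.
case: n => [|n] in A *; first by rewrite !thinmx0.
move=> cop fg0; have := kermxpolyM A cop; rewrite {1}/kermxpoly.
rewrite -[horner_mx A _]/(mxeval A _) fg0 => /eqmx_sym ker_sum.
exact: eqmx_trans ker_sum (kermx0 _ _ _).
Qed.

Lemma mxrank_kermx_mxeval n (A : 'M[F]_n) f g :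
    coprimep f g -> mxeval A (f * g) = 0 ->
  (\rank (kermx (mxeval A f)) + \rank (kermx (mxeval A g)) = n)%N.
Proof.
move=> cop fg0; rewrite -[RHS](mxrank1 F) -(adds_kermx_mxeval cop fg0).
case: n => [|n] in A fg0 *; first by rewrite !thinmx0 !mxrank0.
by rewrite mxrank_disjoint_sum // mxdirect_kermxpoly.
Qed.

End PolynomialInMatrix.

(** * Coprime factors *)

Section BlockDiagonal.
Variables (F : finFieldType) (m n : nat).
Implicit Types (S : {set 'M[F]_m}) (T : {set 'M[F]_n}).

Definition block_diag_set S T := [set block_mx x.1 0 0 x.2 | x in setX S T].

Lemma card_block_diag_set S T : #|block_diag_set S T| = (#|S| * #|T|)%N.
Proof.
by rewrite card_imset ?cardsX // => -[A B] [A' B'] /= /eq_block_mx[-> _ _ ->].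
Qed.

Lemma mem_block_diag_set S T A B :
  A \in S -> B \in T -> block_mx A 0 0 B \in block_diag_set S T.
Proof. by move=> AS BT; apply/imsetP; exists (A, B); rewrite // inE AS. Qed.

Lemma block_diag_setP S T D :
  reflect (exists A B, [/\ A \in S, B \in T & D = block_mx A 0 0 B])
    (D \in block_diag_set S T).
Proof.
apply: (iffP imsetP) => [[[A B] /setXP[AS BT] ->]|[A [B [AS BT ->]]]].
  by exists A, B.
by exists (A, B); rewrite // inE AS.
Qed.

End BlockDiagonal.

Section CoprimeSplitting.
Variable F : finFieldType.
Implicit Types f g : {poly F}.

Definition mxroots f n := [set A : 'M[F]_n | mxeval A f == 0].

Lemma mxroots_conjmx f n (P A : 'M[F]_n) :
  P \in unitmx -> (conjmx P A \in mxroots f n) = (A \in mxroots f n).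
Proof.
move=> Pu; rewrite !inE mxeval_conjmx // conjumx //.
by rewrite mulmx_free_eq0 ?mulmx_full_eq0 ?row_free_unit ?row_full_unit ?unitmx_inv.
Qed.

Lemma block_diag_of_kermx_rank i j (A : 'M[F]_(i + j)) f g :
    coprimep f g -> mxeval A (f * g) = 0 -> \rank (kermx (mxeval A f)) = i ->
  exists2 P, P \in unitmx & conjmx P A \in block_diag_set (mxroots f i) (mxroots g j).
Proof.
move=> cop fg0 rkf; have full := adds_kermx_mxeval cop fg0.
have [V freeV eqV] := row_free_eqmx rkf.
have [|W freeW eqW] := @row_free_eqmx _ _ _ (kermx (mxeval A g)) j.
  by apply/eqP; rewrite -(eqn_add2l i) -{1}rkf mxrank_kermx_mxeval.
have stable r h (Z : 'M_(r, _)) : row_free Z -> (Z :=: kermx (mxeval A h))%MS ->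
    exists2 B, B \in mxroots h r & Z *m A = B *m Z.
  move=> freeZ eqZ; have /submxP[B ZA] : (Z *m A <= Z)%MS.
    rewrite eqZ (eqmxMr _ eqZ); apply: comm_mx_stable_ker.
    exact/esym/mxeval_intertwine.
  exists B => //; rewrite inE -(mulmx_free_eq0 _ freeZ) -(mxeval_intertwine h ZA).
  by apply/eqP/sub_kermxP; rewrite eqZ.
have [B Bf VA] := stable _ f V freeV eqV; have [C Cg WA] := stable _ g W freeW eqW.
have Pu : col_mx V W \in unitmx.
  by rewrite -row_full_unit -sub1mx -addsmxE (adds_eqmx eqV eqW) full.
exists (col_mx V W) => //.
suff /(conjmx_eqP _ _ Pu)/eqP-> : col_mx V W *m A = block_mx B 0 0 C *m col_mx V W.
  exact: mem_block_diag_set.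
by rewrite mul_block_col !mul0mx addr0 add0r mul_col_mx VA WA.
Qed.

Lemma kermx_rank_of_block_diag i j (A P : 'M[F]_(i + j)) f g :
    coprimep f g -> P \in unitmx ->
    conjmx P A \in block_diag_set (mxroots f i) (mxroots g j) ->
  mxeval A (f * g) = 0 /\ \rank (kermx (mxeval A f)) = i.
Proof.
move=> cop Pu /block_diag_setP[B [C [+ + PA]]].
rewrite !inE => /eqP fB /eqP gC.
have {A PA} -> : A = conjmx (invmx P) (block_mx B 0 0 C) by rewrite -PA conjmxK.
have fC := coprimep_mxeval_unit (etrans (coprimep_sym g f) cop) gC.
rewrite !mxeval_conjmx ?unitmx_inv // rmorphM /= !mxeval_block_diag fB gC.
split; first by rewrite -mulmxE mulmx_block !(mul0mx, mulmx0, addr0) block_mx0 conjmx0.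
rewrite mxrank_ker conjVmx // mxrankMfree ?row_free_unit //.
rewrite eqmxMfull ?row_full_unit ?unitmx_inv //.
by rewrite rank_diag_block_mx mxrank0 mxrank_unit // add0n addnK.
Qed.

Lemma block_diag_transporter i j (B : 'M[F]_i) (C : 'M_j) T f g :
    coprimep f g -> T \in unitmx -> B \in mxroots f i -> C \in mxroots g j ->
  (conjmx T (block_mx B 0 0 C) \in block_diag_set (mxroots f i) (mxroots g j)) =
  (T \in block_diag_set (GLset F i) (GLset F j)).
Proof.
rewrite !inE => cop Tu /eqP fB /eqP gC.
apply/idP/block_diag_setP => [/block_diag_setP[B' [C' [+ + TE]]]|[R [S [+ + TE]]]].
  rewrite !inE => /eqP fB' /eqP gC'; move: (Tu); move/eqP/(conjmx_eqP _ _ Tu): TE.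
  rewrite -[T]submxK !mulmx_block !(mul0mx, mulmx0, addr0, add0r).
  case/eq_block_mx=> _ T12 T21 _.
  rewrite (coprimep_intertwine_eq0 _ gC fB' T12) 1?coprimep_sym //.
  rewrite (coprimep_intertwine_eq0 cop fB gC' T21) unitmx_block_lower.
  by case/andP=> Ru Su; exists (ulsubmx T), (drsubmx T); rewrite !inE.
rewrite !inE => Ru Su.
suff /(conjmx_eqP _ _ Tu)/eqP-> : T *m block_mx B 0 0 C =
    block_mx (conjmx R B) 0 0 (conjmx S C) *m T.
  by rewrite mem_block_diag_set // inE mxeval_conjmx // (fB, gC) conjmx0.
rewrite TE !mulmx_block !(mul0mx, mulmx0, addr0, add0r).
by congr block_mx; apply/conjmx_eqP.
Qed.

Lemma card_mxroots_mul i j f g : coprimep f g ->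
  (#|[set A in mxroots (f * g) (i + j) | \rank (kermx (mxeval A f)) == i]|
     * (GLcard F i * GLcard F j) =
   GLcard F (i + j) * (#|mxroots f i| * #|mxroots g j|))%N.
Proof.
move=> cop; rewrite -(card_block_diag_set (GLset F i) (GLset F j)).
rewrite -(card_block_diag_set (mxroots f i)).
apply: card_similarity_closure => [A|P|P A Pu].
- rewrite !inE; split=> [/andP[/eqP fg0 /eqP rkf]|[P Pu PA]].
    exact: block_diag_of_kermx_rank.
  by have [-> ->] := kermx_rank_of_block_diag cop Pu PA; rewrite !eqxx.
- case/block_diag_setP=> R [S []]; rewrite !inE => Ru Su ->.
  by rewrite unitmx_block_lower Ru.
- by case/block_diag_setP=> B [C [fB gC ->]]; apply: block_diag_transporter.
Qed.

Definition mxroot_ps f : ps := fun n => #|mxroots f n|%:R / (GLcard F n)%:R.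

Lemma GLcard_neq0 n : (GLcard F n)%:R != 0 :> rat.
Proof.
rewrite pnatr_eq0 -lt0n; apply/card_gt0P.
by exists 1%:M; rewrite inE unitmx1.
Qed.

Lemma mxroot_ps0 f : mxroot_ps f 0 = 1.
Proof.
rewrite /mxroot_ps -[RHS](divff (GLcard_neq0 0)); congr (_%:R / _).
apply: eq_card => A; rewrite !inE unitmxE det_mx00 unitr1.
by apply/eqP; rewrite [LHS]flatmx0.
Qed.

Lemma mxroot_ps1 n : mxroot_ps 1 n = ps_one n.
Proof.
case: n => [|n]; first exact: mxroot_ps0.
by rewrite /mxroot_ps eq_card0 ?mul0r // => A; rewrite !inE rmorph1 oner_eq0.
Qed.

Lemma mxroot_psM f g n :
  coprimep f g -> mxroot_ps (f * g) n = ps_mul (mxroot_ps f) (mxroot_ps g) n.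
Proof.
move=> cop; rewrite /mxroot_ps -sum1_card natr_sum mulr_suml.
rewrite (partition_big_leq (fun A => \rank (kermx (mxeval A f))) n); last first.
  by move=> A _; apply: rank_leq_row.
apply: eq_bigr => -[i /=]; rewrite ltnS => /subnKC.
move: (n - i)%N => j <- {n} _; rewrite -mulr_suml -natr_sum sum1dep_card.
apply/eqP; rewrite mulf_div eqr_div ?mulf_neq0 ?GLcard_neq0 //.
by rewrite -!natrM card_mxroots_mul // mulnC.
Qed.

Lemma mxroot_ps_prod (I : Type) (s : seq I) (G : I -> {poly F}) m n :
    separable_poly (\prod_(i <- s) G i) ->
  mxroot_ps ((\prod_(i <- s) G i) ^+ m) n =
  ps_prod [seq mxroot_ps (G i ^+ m) | i <- s] n.
Proof.
elim: s n => [|i s IH] n; first by rewrite big_nil expr1n mxroot_ps1.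
rewrite big_cons separable_mul => /and3P[_ sep cop].
rewrite exprMn mxroot_psM ?coprimep_expl ?coprimep_expr //=.
by apply: eq_bigr => j _; rewrite IH.
Qed.

End CoprimeSplitting.

(** * Nilpotent matrices *)

Section FullRank.
Variable F : finFieldType.
Let q : rat := #|F|%:R.

Definition row_full_set l c := [set Z : 'M[F]_(l, c) | row_full Z].

Lemma card_row_full_eq0 l c : (l < c)%N -> #|row_full_set l c| = 0%N.
Proof.
move=> lt_lc; apply: eq_card0 => Z; rewrite !inE.
by apply: contraTF lt_lc => /eqP <-; rewrite -leqNgt rank_leq_row.
Qed.

Lemma card_row_full_col_mx m l n (B : 'M[F]_(m, n)) :
  #|[set C : 'M_(l, n) | row_full (col_mx B C)]| =
  (#|F| ^ (l * \rank B) * #|row_full_set l (n - \rank B)|)%N.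
Proof.
have [j rkB] : {j | \rank B = j} by exists (\rank B).
rewrite rkB; have : (j + (n - j) = n)%N by rewrite -rkB subnKC ?rank_leq_col.
move: (n - j)%N => c En; case: n / En B rkB => B rkB.
pose ext (x : 'M_(l, j) * 'M_(l, c)) := row_mx x.1 x.2 *m row_ebase B.
rewrite -card_mx -cardsT -cardsX -[RHS](card_imset _ (f := ext)); last first.
  case=> C1 C2 [D1 D2] /(can_inj (mulmxK (row_ebase_unit B))) /eq_row_mx[].
  by move=> /= -> ->.
apply: eq_card => C; rewrite inE; apply/idP/imsetP => [fullC|[[C1 C2]]].
  pose C' := C *m invmx (row_ebase B).
  have CE : C = ext (lsubmx C', rsubmx C').
    by rewrite /ext hsubmxK mulmxKV ?row_ebase_unit.
  exists (lsubmx C', rsubmx C') => //; move: fullC.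
  by rewrite !inE CE row_full_col_mx_ebase.
by rewrite !inE /= => fullC2 ->; rewrite row_full_col_mx_ebase.
Qed.

Lemma GLcard_add c d :
  (GLcard F (c + d) = #|row_full_set (c + d) c| * (#|F| ^ (d * c) * GLcard F d))%N.
Proof.
have -> : #|row_full_set (c + d) c| = #|[set B : 'M[F]_(c, c + d) | row_free B]|.
  rewrite -(card_imset _ (can_inj (@trmxK _ _ _))); apply: eq_card => B.
  apply/imsetP/idP => [[Z + ->]|]; rewrite !inE.
    by rewrite /row_full /row_free mxrank_tr.
  by exists B^T; rewrite ?trmxK // inE /row_full mxrank_tr.
rewrite -sum_nat_const.
rewrite -[LHS]sum1_card (partition_big usubmx [in [set B | row_free B]]) /=.
  apply: eq_bigr => B; rewrite inE => /eqP freeB.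
  transitivity #|[set C : 'M_(d, c + d) | row_full (col_mx B C)]|.
    rewrite -(card_imset _ (f := col_mx B)); last by move=> C C' /eq_col_mx[].
    rewrite -sum1_card; apply: eq_bigl => P; rewrite inE.
    apply/andP/imsetP => [[Pu /eqP <-]|[C + ->]].
      by exists (dsubmx P); rewrite ?inE vsubmxK ?row_full_unit.
    by rewrite inE row_full_unit col_mxKu.
  rewrite card_row_full_col_mx freeB addKn; congr (_ * _)%N.
  by apply: eq_card => Z; rewrite !inE row_full_unit.
by move=> P; rewrite !inE; apply: row_free_usubmx.
Qed.

Definition qpochhammer (x : rat) n : rat := \prod_(1 <= j < n.+1) (1 - (x ^+ j)^-1).

Lemma cardF_neq0 : q != 0.
Proof. by rewrite pnatr_eq0 -lt0n (ltn_trans _ (finNzRing_gt1 F)). Qed.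

Lemma GLcardE n : (GLcard F n)%:R = q ^+ (n ^ 2) * qpochhammer q n.
Proof.
have -> : GLcard F n = (#|F| ^ 'C(n, 2) * \prod_(1 <= i < n.+1) (#|F| ^ i - 1))%N.
  case: n => [|n].
    rewrite /GLcard big_geq // (@eq_card1 _ (0 : 'M_0)) // => A.
    by rewrite !inE unitmxE det_mx00 unitr1 [A]flatmx0 eqxx.
  by rewrite -card_GL // cardsT /= card_sub; apply: eq_card => A; rewrite !inE.
rewrite natrM natrX -/q /qpochhammer.
elim: n => [|n IH]; first by rewrite !big_geq.
rewrite !(@big_nat_recr _ _ _ n.+1) //= natrM binS bin1 exprD.
have -> : (#|F| ^ n.+1 - 1)%:R = q ^+ n.+1 * (1 - (q ^+ n.+1)^-1).
  rewrite mulrBr mulr1 divff ?expf_neq0 ?cardF_neq0 // natrB ?natrX //.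
  by rewrite expn_gt0 (ltn_trans _ (finNzRing_gt1 F)).
have -> : (n.+1 ^ 2 = n ^ 2 + (n + n.+1))%N by rewrite -addn1 sqrnD; lia.
rewrite !exprD mulrACA IH; ring.
Qed.

Lemma qpochhammer_neq0 n : qpochhammer q n != 0.
Proof. by have := GLcard_neq0 F n; rewrite GLcardE mulf_eq0 => /norP[]. Qed.

Lemma card_row_full l c : (c <= l)%N ->
  #|row_full_set l c|%:R = q ^+ (l * c) * (qpochhammer q l / qpochhammer q (l - c)).
Proof.
move/subnKC; move: (l - c)%N => d <- {l}.
have := congr1 (fun n => n%:R : rat) (GLcard_add c d).
rewrite !natrM natrX !GLcardE -/q => GLE.
have q0 := cardF_neq0; have qd0 := qpochhammer_neq0 d.
apply: (mulIf (x := q ^+ (d * c) * (q ^+ (d ^ 2) * qpochhammer q d))).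
  by rewrite !mulf_neq0 ?expf_neq0.
rewrite -GLE (_ : (c + d) ^ 2 = (c + d) * c + d * c + d ^ 2)%N; last by lia.
by rewrite !exprD; field.
Qed.

End FullRank.

Section NilpotentMatrices.
Variable F : finFieldType.
Let q : rat := #|F|%:R.

Lemma mem_mxroots_Xn s n (N : 'M[F]_n) : (N \in mxroots 'X^s n) = (N ^+ s == 0).
Proof. by rewrite inE mxevalXn. Qed.

Definition nilpotents_of_rank s n k :=
  [set N in mxroots ('X^s : {poly F}) n | \rank N == k].

Lemma nilpotents_of_rank_conjmx s n k (P N : 'M[F]_n) : P \in unitmx ->
  (conjmx P N \in nilpotents_of_rank s n k) = (N \in nilpotents_of_rank s n k).
Proof.
by move=> Pu; apply/setIdP/setIdP; rewrite mxroots_conjmx // mxrank_conjmx.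
Qed.

Section FixedRank.
Variables (s k l : nat).

(* The stabilizer of the span of the first [k] basis vectors. *)
Definition block_lower_units := [set P in GLset F (k + l) | ursubmx P == 0].

Lemma card_block_lower_units :
  #|block_lower_units| = (GLcard F k * GLcard F l * #|F| ^ (l * k))%N.
Proof.
pose mk (x : 'M_k * 'M_l * 'M_(l, k)) : 'M[F]_(k + l) := block_mx x.1.1 0 x.2 x.1.2.
have mk_inj : injective mk.
  by move=> [[A B] C] [[A' B'] C'] /eq_block_mx[/= -> _ -> ->].
transitivity #|mk @: setX (setX (GLset F k) (GLset F l)) setT|.
  apply: eq_card => P; rewrite !inE; apply/andP/imsetP => [[Pu /eqP P0]|].
    exists ((ulsubmx P, drsubmx P), dlsubmx P); last by rewrite /mk -P0 submxK.
    by move: Pu; rewrite !inE -{1}[P]submxK P0 unitmx_block_lower => ->.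
  case=> -[[A B] C]; rewrite !inE /= andbT => ABu ->.
  by rewrite unitmx_block_lower block_mxKur.
by rewrite card_imset // !cardsX cardsT card_mx.
Qed.

Definition nilpotents_onto_first :=
  [set N in nilpotents_of_rank s.+1 (k + l) k | rsubmx N == 0].

Definition nilpotent_usubmx_set :=
  [set Y : 'M[F]_(k + l, k) | (usubmx Y \in mxroots 'X^s k) && row_full Y].

(* [usubmx Y] is the restriction of [row_mx Y 0] to its image. *)
Lemma card_nilpotents_onto_first : #|nilpotents_onto_first| = #|nilpotent_usubmx_set|.
Proof.
have inj_row : injective (row_mx^~ (0 : 'M[F]_(k + l, l)) : 'M_(k + l, k) -> _).
  by move=> Y Y' /eq_row_mx[].
rewrite -[RHS](card_imset _ inj_row); apply: eq_card => N.
have nilE (Y : 'M[F]_(k + l, k)) : row_full Y ->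
    (row_mx Y 0 \in mxroots 'X^(s.+1) (k + l)) = (usubmx Y \in mxroots 'X^s k).
  move=> fullY; have -> : row_mx Y 0 = Y *m row_mx 1%:M (0 : 'M_(k, l)).
    by rewrite mul_mx_row mulmx1 mulmx0.
  rewrite !mem_mxroots_Xn mulmx_exprS -{2}[Y]vsubmxK mul_row_col mul1mx mul0mx addr0.
  by rewrite mulmx_free_eq0 ?mulmx_full_eq0 // /row_free rank_row_mx0 mxrank1.
apply/setIdP/imsetP => [[/setIdP[N0 rkN] /eqP NE]|[Y]].
  have {NE} NE : N = row_mx (lsubmx N) 0 by rewrite -{1}[N]hsubmxK NE.
  exists (lsubmx N) => //; move: N0 rkN; rewrite {1 2}NE rank_row_mx0 => N0 fullN.
  by rewrite [_ \in nilpotent_usubmx_set]inE -nilE // N0.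
rewrite inE => /andP[Y0 fullY] ->; rewrite inE nilE // Y0 row_mxKr eqxx.
by rewrite rank_row_mx0.
Qed.

Lemma nilpotents_onto_first_transporter P N :
    P \in unitmx -> N \in nilpotents_onto_first ->
  (conjmx P N \in nilpotents_onto_first) = (P \in block_lower_units).
Proof.
move=> Pu /setIdP[NR /eqP N0]; rewrite inE nilpotents_of_rank_conjmx // NR.
rewrite [P \in _]inE [P \in _]inE Pu /=; set B := conjmx P N.
have rkB : \rank B = k by rewrite mxrank_conjmx //; apply/eqP; case/setIdP: NR.
have /(conjmx_eqP _ _ Pu) : conjmx P N == B by [].
rewrite -{1}[N]hsubmxK N0 -{1}[B]hsubmxK -{2}[P]submxK mul_mx_row mulmx0 mul_row_block.
case/eq_row_mx => _ /esym PB; apply/eqP/eqP => [B2|P2].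
  have fullB : row_full (lsubmx B).
    apply/eqP; rewrite -[RHS]rkB -[in RHS](hsubmxK B) B2.
    by rewrite rank_row_mx0.
  by apply/eqP; rewrite -(mulmx_full_eq0 _ fullB) -PB B2 mul0mx addr0.
have freeP22 : row_free (drsubmx P).
  by move: Pu; rewrite row_free_unit -{1}[P]submxK P2 unitmx_block_lower => /andP[].
by apply/eqP; rewrite -(mulmx_free_eq0 _ freeP22) -PB P2 mulmx0 add0r.
Qed.

Lemma card_nilpotents_of_rank :
  (#|nilpotents_of_rank s.+1 (k + l) k| * (GLcard F k * GLcard F l * #|F| ^ (l * k)) =
   GLcard F (k + l) * #|nilpotent_usubmx_set|)%N.
Proof.
rewrite -card_block_lower_units -card_nilpotents_onto_first.
apply: card_similarity_closure => [A|P|]; last exact: nilpotents_onto_first_transporter.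
  split=> [AR|[P Pu /setIdP[]]]; last by rewrite nilpotents_of_rank_conjmx.
  have Pu := row_ebase_unit A; exists (row_ebase A); rewrite // inE.
  rewrite nilpotents_of_rank_conjmx // AR conjumx // -{2}[A]mulmx_ebase.
  case/setIdP: AR => _ /eqP->; rewrite -!mulmxA mulmxV // mulmx1.
  by rewrite pid_mx_block block_mxEh col_mx0 !mul_mx_row !mulmx0 row_mxKr eqxx.
by case/setIdP; rewrite inE.
Qed.

Lemma card_nilpotent_usubmx_set :
  #|nilpotent_usubmx_set| =
  (\sum_(U in mxroots ('X^s : {poly F}) k)
     #|F| ^ (l * \rank U) * #|row_full_set F l (k - \rank U)|)%N.
Proof.
rewrite -sum1_card (partition_big usubmx [in mxroots 'X^s k]) /=; last first.
  by move=> Y; rewrite inE => /andP[].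
apply: eq_bigr => U U0; rewrite -card_row_full_col_mx.
rewrite -(card_imset _ (f := col_mx U)); last by move=> D D' /eq_col_mx[].
rewrite -sum1_card; apply: eq_bigl => Y; rewrite inE.
apply/andP/imsetP => [[/andP[_ fullY] /eqP <-]|[D]].
  by exists (dsubmx Y); rewrite ?inE vsubmxK.
by rewrite inE => fullD ->; rewrite col_mxKu U0.
Qed.

End FixedRank.

Definition nilpotents_of_corank s m a :=
  [set N in mxroots ('X^s : {poly F}) m | (m - \rank N == a)%N].

Lemma nilpotents_of_corank_addn s k a :
  nilpotents_of_corank s (k + a) a = nilpotents_of_rank s (k + a) k.
Proof.
apply/setP => N; rewrite !in_set; congr (_ && _).
by have le_rk := rank_leq_row N; apply/eqP/eqP; lia.
Qed.

Lemma card_nilpotent_usubmx_set_corank s k a :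
  #|nilpotent_usubmx_set s k a|%:R =
  q ^+ (a * k) * qpochhammer q a *
  \sum_(c < a.+1) #|nilpotents_of_corank s k c|%:R / qpochhammer q (a - c).
Proof.
rewrite card_nilpotent_usubmx_set natr_sum.
pose corank (U : 'M[F]_k) := (k - \rank U)%N.
rewrite (bigID (fun U => corank U <= a)%N) /= [X in _ + X]big1 ?addr0; last first.
  by move=> U /andP[_]; rewrite -ltnNge => /card_row_full_eq0 ->; rewrite muln0.
rewrite (partition_big_leq corank a); last by move=> U /andP[].
rewrite mulr_sumr; apply: eq_bigr => -[c /=]; rewrite ltnS => le_ca _.
rewrite -[in RHS]sum1_card natr_sum mulr_suml mulr_sumr; apply: eq_big => U.
  by rewrite [RHS]inE -andbA; case: eqP => [->|]; rewrite ?le_ca ?andbF.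
case/andP=> _ /eqP cork; rewrite -/(corank U) cork natrM natrX card_row_full // -/q.
have -> : (a * k = a * \rank U + a * c)%N.
  by rewrite -mulnDr -cork subnKC // rank_leq_row.
by rewrite exprD; field; rewrite qpochhammer_neq0.
Qed.

Definition corank_ratio s a m : rat :=
  #|nilpotents_of_corank s m a|%:R / (GLcard F m)%:R.

Lemma mxroot_ps_Xn_corank s m :
  mxroot_ps ('X^s : {poly F}) m = \sum_(a < m.+1) corank_ratio s a m.
Proof.
rewrite /mxroot_ps -sum1_card natr_sum mulr_suml.
rewrite (partition_big_leq (fun N => m - \rank N)%N m); last first.
  by move=> N _; apply: leq_subr.
by apply: eq_bigr => a _; rewrite -mulr_suml -natr_sum sum1dep_card.
Qed.

Lemma corank_ratio_eq0 s a m : (m < a)%N -> corank_ratio s a m = 0.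
Proof.
move=> lt_ma; rewrite /corank_ratio eq_card0 ?mul0r // => N; rewrite !inE.
apply/andP => -[_ /eqP cork].
by have := leq_subr (\rank N) m; rewrite cork leqNgt lt_ma.
Qed.

Lemma corank_ratio0 a m : corank_ratio 0 a m = ((a == 0%N) && (m == 0%N))%:R.
Proof.
have [->|m_neq0] := eqVneq m 0%N; last first.
  case: m m_neq0 => // m _; rewrite andbF /corank_ratio eq_card0 ?mul0r // => N.
  by rewrite !inE rmorph1 oner_eq0.
have [->|a_neq0] := eqVneq a 0%N; last by rewrite corank_ratio_eq0 // lt0n.
by rewrite -[RHS](mxroot_ps0 ('X^0 : {poly F})) mxroot_ps_Xn_corank big_ord1.
Qed.

Lemma corank_ratioS s a m : (a <= m)%N ->
  corank_ratio s.+1 a m =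
  (q ^+ (a ^ 2))^-1 *
  \sum_(c < a.+1) corank_ratio s c (m - a)%N / qpochhammer q (a - c)%N.
Proof.
move/subnK; move: (m - a)%N => k <- {m}.
have := congr1 (fun n => n%:R : rat) (card_nilpotents_of_rank s k a).
rewrite -nilpotents_of_corank_addn !natrM natrX.
rewrite card_nilpotent_usubmx_set_corank -/q => card_eq.
have -> : \sum_(c < a.+1) corank_ratio s c k / qpochhammer q (a - c) =
    (\sum_(c < a.+1) #|nilpotents_of_corank s k c|%:R / qpochhammer q (a - c)) /
    (GLcard F k)%:R.
  by rewrite mulr_suml; apply: eq_bigr => c _; rewrite mulrAC.
rewrite /corank_ratio; set S := \sum_(c < _) _ in card_eq *.
have q0 := cardF_neq0 F; have [GL0 qa0] := (GLcard_neq0 F, qpochhammer_neq0 F a).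
have -> : #|nilpotents_of_corank s.+1 (k + a) a|%:R =
    (GLcard F (k + a))%:R * S / ((GLcard F k)%:R * q ^+ (a ^ 2)).
  apply: (mulIf (x := (GLcard F k)%:R * (GLcard F a)%:R * q ^+ (a * k))).
    by rewrite !mulf_neq0 ?expf_neq0.
  by rewrite card_eq (GLcardE F a) -/q; field; rewrite !expf_neq0 ?GL0.
by field; rewrite expf_neq0 ?GL0.
Qed.

End NilpotentMatrices.

(** * Partitions *)

Section Partitions.

Definition is_partition m (l : seq nat) :=
  [&& sorted geq l, all (ltn 0) l & sumn l == m].

Lemma geq_trans : transitive geq.
Proof. by move=> n m p /= nm pn; apply: leq_trans pn nm. Qed.

Lemma mem_leq_sumn (l : seq nat) y : y \in l -> (y <= sumn l)%N.
Proof. by elim: l => //= z l IH; rewrite inE => /predU1P[->|/IH]; lia. Qed.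

Lemma size_leq_sumn (l : seq nat) : all (ltn 0) l -> (size l <= sumn l)%N.
Proof. by elim: l => //= y l IH /andP[y0 /IH]; lia. Qed.

Lemma size_partition_leq m l : is_partition m l -> (size l <= m)%N.
Proof. by case/and3P=> _ pl /eqP<-; apply: size_leq_sumn. Qed.

Lemma lam1_leq l s : sorted geq l -> (lam1 l <= s)%N = all (geq s) l.
Proof.
case: l => [|x l]; rewrite /lam1 //= (path_sortedE geq_trans) => /andP[lex _].
apply/idP/andP => [xs|[]//]; split=> //; apply/allP => y /(allP lex) /=.
by move/leq_trans; apply.
Qed.

Lemma nth_filter_gt0 l i : sorted geq l ->
  nth 0%N [seq x <- l | (0 < x)%N] i = nth 0%N l i.
Proof.
elim: l i => //= x l IH i; rewrite (path_sortedE geq_trans) => /andP[lex sl].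
case: x lex => [|x] lex /=; last by case: i => //= i; apply: IH.
have -> : l = nseq (size l) 0%N.
  by apply/all_pred1P/allP => y /(allP lex); rewrite /= leqn0.
by rewrite filter_nseq nth_nil; case: i => //= i; rewrite nth_nseq if_same.
Qed.

Lemma sumn_filter_gt0 l : sumn [seq x <- l | (0 < x)%N] = sumn l.
Proof. by elim: l => //= -[|x] l /= ->. Qed.

Section Codes.
Variable m : nat.
Implicit Type f : {ffun 'I_m -> 'I_m.+1}.

Definition code_seq f := [seq (f i : nat) | i <- enum 'I_m].

Lemma nth_code_seq f (i : 'I_m) : nth 0%N (code_seq f) i = f i.
Proof. by rewrite (nth_map i) ?nth_ord_enum ?size_enum_ord. Qed.

Lemma sorted_code_seq f : is_partition_code f -> sorted geq (code_seq f).
Proof.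
case/andP=> /'forall_forallP mono _; apply/(sortedP 0%N) => i.
rewrite size_map size_enum_ord => lt_i1m; have lt_im := ltnW lt_i1m.
rewrite (nth_code_seq f (Ordinal lt_im)) (nth_code_seq f (Ordinal lt_i1m)).
by have /implyP/(_ (leqnSn i)) := mono (Ordinal lt_im) (Ordinal lt_i1m).
Qed.

Lemma sumn_code_seq f : sumn (code_seq f) = (\sum_(i < m) f i)%N.
Proof. by rewrite sumnE big_map big_enum. Qed.

Lemma parts_inj : {in @is_partition_code m &, injective (@parts m)}.
Proof.
move=> f g /sorted_code_seq sf /sorted_code_seq sg fg.
apply/ffunP => i; apply: val_inj; rewrite /= -!nth_code_seq.
by rewrite -(nth_filter_gt0 i sf) -(nth_filter_gt0 i sg) -/(parts f) fg.
Qed.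

Lemma is_partition_parts f : is_partition_code f -> is_partition m (parts f).
Proof.
move=> code_f; apply/and3P; split; last 1 first.
- by rewrite sumn_filter_gt0 sumn_code_seq; case/andP: code_f.
- exact: sorted_filter geq_trans _ _ (sorted_code_seq code_f).
- exact: filter_all.
Qed.

Lemma parts_surj l : is_partition m l ->
  exists2 f : {ffun 'I_m -> 'I_m.+1}, is_partition_code f & l = parts f.
Proof.
move=> lP; have [sl pl /eqP sum] := and3P lP.
have le_m i : (nth 0%N l i < m.+1)%N.
  rewrite ltnS; have [il|il] := ltnP i (size l); last by rewrite nth_default.
  by rewrite -[leqRHS]sum mem_leq_sumn // mem_nth.
pose f : {ffun 'I_m -> 'I_m.+1} := [ffun i : 'I_m => Ordinal (le_m i)].
have fE : code_seq f = l ++ nseq (m - size l) 0%N.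
  apply: (@eq_from_nth _ 0%N) => [|i].
    by rewrite size_map size_enum_ord size_cat size_nseq subnKC // size_partition_leq.
  rewrite size_map size_enum_ord => im.
  rewrite (nth_code_seq f (Ordinal im)) ffunE /= nth_cat nth_nseq if_same.
  by case: ltnP => // il; rewrite nth_default.
exists f; last first.
  rewrite /parts -/(code_seq f) fE filter_cat filter_nseq cats0.
  exact/esym/all_filterP.
apply/andP; split; last by rewrite -sumn_code_seq fE sumn_cat sumn_nseq addn0 sum.
apply/'forall_forallP => i j; apply/implyP => ij; rewrite !ffunE /=.
have [jl|jl] := ltnP j (size l); last by rewrite [leqLHS]nth_default.
by apply: (sorted_leq_nth geq_trans leqnn 0%N sl) => //; apply: leq_ltn_trans jl.
Qed.

Definition partitions := [seq parts f | f <- enum (@is_partition_code m)].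

Lemma uniq_partitions : uniq partitions.
Proof.
by rewrite map_inj_in_uniq ?enum_uniq // => f g; rewrite !mem_enum; apply: parts_inj.
Qed.

Lemma mem_partitions l : (l \in partitions) = is_partition m l.
Proof.
apply/mapP/idP => [[f]|/parts_surj[f]]; last by exists f; rewrite ?mem_enum.
by rewrite mem_enum => /is_partition_parts + ->.
Qed.

End Codes.

Lemma partitions0 : partitions 0 = [:: [::]].
Proof.
apply: perm_small_eq => //; apply: uniq_perm; rewrite ?uniq_partitions // => l.
rewrite mem_partitions inE; apply/idP/eqP => [/size_partition_leq|-> //].
by rewrite leqn0 => /nilP.
Qed.

(* Columns are those of the Young diagram whose rows are the parts. *)
Definition add_column a (l : seq nat) := map succn l ++ nseq (a - size l) 1%N.
Definition remove_column (l : seq nat) := [seq x <- map predn l | (0 < x)%N].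

Lemma add_columnK a l : all (ltn 0) l -> remove_column (add_column a l) = l.
Proof.
move=> pl; rewrite /remove_column /add_column map_cat filter_cat -map_comp.
by rewrite (eq_map (g := id)) // map_id map_nseq filter_nseq cats0; apply/all_filterP.
Qed.

Lemma remove_columnK l : sorted geq l -> all (ltn 0) l ->
  add_column (size l) (remove_column l) = l.
Proof.
elim: l => //= x l IH; rewrite (path_sortedE geq_trans) => /andP[lex sl].
case/andP=> x0 pl; have := IH sl pl; rewrite /add_column /remove_column /=.
case: x x0 lex => // -[|x] _ lex /= E; last by rewrite subSS; congr cons.
have -> : l = nseq (size l) 1%N.
  apply/all_pred1P/allP => y yl; have /= := allP lex _ yl; have /= := allP pl _ yl; lia.
by rewrite map_nseq filter_nseq /= size_nseq.
Qed.

Lemma size_add_column a l : (size l <= a)%N -> size (add_column a l) = a.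
Proof. by rewrite size_cat size_map size_nseq => /subnKC. Qed.

Lemma sumn_add_column a l : (size l <= a)%N -> sumn (add_column a l) = (sumn l + a)%N.
Proof.
move=> sa; have sumn_succ k : sumn (map succn k) = (sumn k + size k)%N.
  by elim: k => //= x k ->; lia.
by rewrite sumn_cat sumn_succ sumn_nseq mul1n -addnA subnKC.
Qed.

Lemma sumn_remove_column l :
  all (ltn 0) l -> sumn (remove_column l) = (sumn l - size l)%N.
Proof.
rewrite sumn_filter_gt0; elim: l => //= x l IH /andP[x0 pl].
by have := size_leq_sumn pl; rewrite IH //; lia.
Qed.

Lemma sorted_add_column a l : sorted geq l -> sorted geq (add_column a l).
Proof.
move=> sl; rewrite (sorted_pairwise geq_trans) pairwise_cat.
rewrite -!(sorted_pairwise geq_trans).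
apply/and3P; split.
- by apply/allrelP => x y /mapP[z _ ->]; rewrite mem_nseq => /andP[_ /eqP->].
- by rewrite sorted_map; apply: sub_sorted sl.
- by elim: (a - size l)%N => //= n IH; case: n IH => //= n ->.
Qed.

Lemma sorted_remove_column l : sorted geq l -> sorted geq (remove_column l).
Proof.
move=> sl; apply: sorted_filter; first exact: geq_trans.
by rewrite sorted_map; apply: sub_sorted sl => x y /=; lia.
Qed.

Lemma add_column_partition m a s l :
    (a <= m)%N -> (size l <= a)%N -> is_partition (m - a)%N l -> (lam1 l <= s)%N ->
  is_partition m (add_column a l) /\ (lam1 (add_column a l) <= s.+1)%N.
Proof.
move=> am sa /and3P[sl pl /eqP sum] ls; have srt := sorted_add_column a sl; split.
  apply/and3P; split=> //; last by rewrite sumn_add_column // sum subnK.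
  by rewrite all_cat all_nseq orbT andbT all_map; apply/allP.
rewrite lam1_leq // all_cat all_nseq /= orbT andbT all_map.
by rewrite lam1_leq // in ls.
Qed.

Lemma remove_column_partition m s l :
    is_partition m l -> (lam1 l <= s.+1)%N ->
  [/\ is_partition (m - size l)%N (remove_column l), (lam1 (remove_column l) <= s)%N &
    (size (remove_column l) <= size l)%N].
Proof.
case/and3P=> sl pl /eqP sum ls; have srt := sorted_remove_column sl.
split; last by rewrite size_filter (leq_trans (count_size _ _)) ?size_map.
  by apply/and3P; split; rewrite ?filter_all // sumn_remove_column // sum.
rewrite lam1_leq //; apply/allP => y; rewrite mem_filter => /andP[_ /mapP[z zl ->]].
by move: ls; rewrite lam1_leq // => /allP/(_ z zl) /=; lia.
Qed.

Lemma perm_add_column m a s : (a <= m)%N ->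
  perm_eq [seq l <- partitions m | (lam1 l <= s.+1)%N && (size l == a)]
    [seq add_column a l |
       l <- [seq l <- partitions (m - a)%N | (lam1 l <= s)%N && (size l <= a)%N]].
Proof.
move=> am; apply: uniq_perm; first by rewrite filter_uniq ?uniq_partitions.
  rewrite map_inj_in_uniq ?filter_uniq ?uniq_partitions // => l l'.
  rewrite !mem_filter !mem_partitions.
  move=> /andP[_ /and3P[_ pl _]] /andP[_ /and3P[_ pl' _]] eq_add.
  by rewrite -(add_columnK a pl) eq_add add_columnK.
move=> l; apply/idP/mapP => [|[l']]; rewrite mem_filter mem_partitions.
  case/andP=> /andP[ls /eqP <-] lP; exists (remove_column l).
    rewrite mem_filter mem_partitions.
    by have [-> -> ->] := remove_column_partition lP ls.
  by case/and3P: lP => sl pl _; rewrite remove_columnK.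
case/andP=> /andP[ls sa] lP ->.
rewrite mem_filter mem_partitions size_add_column // eqxx.
by have [-> ->] := add_column_partition am sa lP ls.
Qed.

Lemma conjp_add_column1 a l : (size l <= a)%N -> conjp (add_column a l) 1 = a.
Proof.
move=> sa; rewrite -[RHS](size_add_column sa) /conjp; apply/eqP; rewrite -all_count.
by rewrite all_cat all_map all_nseq orbT andbT; apply/allP.
Qed.

Lemma conjp_add_columnS a l i : (0 < i)%N -> conjp (add_column a l) i.+1 = conjp l i.
Proof.
move=> i0; rewrite /conjp count_cat count_map count_nseq ltnS leqNgt i0 addn0.
exact: eq_count.
Qed.

Lemma multp_add_column1 a l :
  all (ltn 0) l -> multp (add_column a l) 1 = (a - size l)%N.
Proof.
move=> /allP pl; rewrite /multp count_cat count_map count_nseq /= mul1n.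
rewrite (eq_in_count (a2 := pred0)) ?count_pred0 // => y /pl /=; lia.
Qed.

Lemma multp_add_columnS a l i : (0 < i)%N -> multp (add_column a l) i.+1 = multp l i.
Proof.
move=> i0; rewrite /multp count_cat count_map count_nseq.
rewrite /= eqSS eq_sym eqn0Ngt i0 addn0.
exact: eq_count.
Qed.

Section Weights.
Variable x : rat.

Definition partition_weight N (l : seq nat) : rat :=
  (x ^+ (\sum_(1 <= i < N.+1) conjp l i ^ 2)%N *
   \prod_(1 <= i < N.+1) qpochhammer x (multp l i))^-1.

Lemma partition_weightS N l : all (geq N) l ->
  partition_weight N.+1 l = partition_weight N l.
Proof.
move=> /allP leN; rewrite /partition_weight !(@big_nat_recr _ _ _ N.+1) //=.
have -> : conjp l N.+1 = 0%N.
  by rewrite /conjp (eq_in_count (a2 := pred0)) ?count_pred0 // => y /leN /=; lia.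
have -> : multp l N.+1 = 0%N.
  by rewrite /multp (eq_in_count (a2 := pred0)) ?count_pred0 // => y /leN /=; lia.
by rewrite addn0 /qpochhammer [X in _ * (_ * X)]big_geq ?mulr1.
Qed.

Lemma partition_weight_widen M N l : (M <= N)%N -> all (geq M) l ->
  partition_weight N l = partition_weight M l.
Proof.
move=> /subnK <- leM; elim: (N - M)%N => //= n IH; rewrite addSn partition_weightS //.
by apply: sub_all leM => y /= yM; rewrite (leq_trans yM) ?leq_addl.
Qed.

Lemma partition_weight_add_column N a l : all (ltn 0) l -> (size l <= a)%N ->
  partition_weight N.+1 (add_column a l) =
  (x ^+ (a ^ 2))^-1 * (partition_weight N l / qpochhammer x (a - size l)%N).
Proof.
move=> pl sa; rewrite /partition_weight.
rewrite big_ltn // [X in _ * X]big_ltn // !big_add1 /=.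
rewrite conjp_add_column1 // multp_add_column1 //.
under eq_big_nat => i /andP[i0 _] do rewrite conjp_add_columnS //.
under [X in _ * (_ * X)]eq_big_nat => i /andP[i0 _] do rewrite multp_add_columnS //.
by rewrite exprD !invfM; ring.
Qed.

Definition partition_sum s a m : rat :=
  \sum_(l <- partitions m | (lam1 l <= s)%N && (size l == a)) partition_weight m l.

Lemma partition_sumS s a m : (a <= m)%N ->
  partition_sum s.+1 a m =
  (x ^+ (a ^ 2))^-1 *
  \sum_(c < a.+1) partition_sum s c (m - a)%N / qpochhammer x (a - c)%N.
Proof.
move=> am; rewrite /partition_sum -big_filter (perm_big _ (perm_add_column s am)) /=.
rewrite big_map big_filter (partition_big_leq size a); last first.
  by move=> l /andP[].
rewrite mulr_sumr; apply: eq_bigr => -[c /=]; rewrite ltnS => le_ca _.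
rewrite mulr_suml mulr_sumr [LHS]big_seq_cond [RHS]big_seq_cond.
apply: eq_big => l; first by rewrite -!andbA; case: eqP => [->|]; rewrite ?le_ca ?andbF.
rewrite mem_partitions => /and3P[lP /andP[_ sa] /eqP <-].
have /and3P[_ pl /eqP sum] := lP.
have le_sum (k : seq nat) : all (geq (sumn k)) k.
  by apply/allP => y; apply: mem_leq_sumn.
rewrite -[in LHS](@partition_weight_widen m m.+1) //; last first.
  by rewrite -{1}(subnK am) -sum -sumn_add_column ?le_sum.
rewrite partition_weight_add_column // (@partition_weight_widen (m - a)%N) ?leq_subr //.
by rewrite -sum le_sum.
Qed.

Lemma partition_sum_eq0 s a m : (m < a)%N -> partition_sum s a m = 0.
Proof.
move=> ma; rewrite /partition_sum big_seq_cond big_pred0 // => l.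
rewrite mem_partitions; apply/negP => /and3P[/size_partition_leq sl _ /eqP size_l].
by move: ma; rewrite -size_l ltnNge sl.
Qed.

Lemma partition_sum0 a m : partition_sum 0 a m = ((a == 0%N) && (m == 0%N))%:R.
Proof.
have nil_of_lam0 l : is_partition m l -> (lam1 l <= 0)%N -> l = [::].
  by case: l => [|y l] //= /and3P[_ /andP[+ _] _]; rewrite /lam1 /=; case: y.
rewrite /partition_sum; have [m0|m_neq0] := eqVneq m 0%N; last first.
  rewrite andbF big_seq_cond big_pred0 // => l; rewrite mem_partitions.
  apply/negP => /and3P[lP l0 _]; case/negP: m_neq0.
  by move: (lP); rewrite (nil_of_lam0 l) // => /and3P[_ _ /eqP <-].
rewrite m0 partitions0 andbT.
rewrite big_mkcond big_seq1 eq_sym; case: eqP => //= _.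
by rewrite /partition_weight !big_geq // expr0 mulr1 invr1.
Qed.

End Weights.

Lemma part_termE q e l : part_term q e l = partition_weight (q%:R ^+ e) (sumn l) l.
Proof.
rewrite /part_term /partition_weight exprM; congr (_ * _)^-1.
by apply: eq_bigr => i _; apply: eq_bigr => j _; rewrite exprM.
Qed.

Lemma factor_psM q e s m : (0 < e)%N ->
  factor_ps q e s (m * e) = \sum_(a < m.+1) partition_sum (q%:R ^+ e) s a m.
Proof.
move=> e0; transitivity (\sum_(l <- partitions m | (lam1 l <= s)%N) part_term q e l).
  rewrite /factor_ps muln_eq0 [e == _]eqn0Ngt e0 orbF dvdn_mull // mulnK //.
  case: eqP => [->|_]; last by rewrite big_map big_enum_cond.
  rewrite partitions0 big_mkcond big_seq1 /part_term /= !big_geq //.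
  by rewrite muln0 expr0 mulr1 invr1.
rewrite big_seq_cond (partition_big_leq size m); last first.
  by move=> l; rewrite mem_partitions => /andP[/size_partition_leq].
apply: eq_bigr => a _; rewrite /partition_sum [RHS]big_seq_cond.
apply: eq_big => l; rewrite mem_partitions -andbA // => /andP[/and3P[_ _ /eqP sum] _].
by rewrite part_termE sum.
Qed.

End Partitions.

Theorem mxroot_ps_Xn (K : finFieldType) q e s m : (0 < e)%N -> #|K| = (q ^ e)%N ->
  mxroot_ps ('X^s : {poly K}) m = factor_ps q e s (m * e).
Proof.
move=> e0 cardK; rewrite mxroot_ps_Xn_corank factor_psM // -natrX -cardK.
apply: eq_bigr => -[a /= _] _; elim: s m a => [|s IH] m a.
  by rewrite corank_ratio0 partition_sum0.
have [am|ma] := leqP a m; last by rewrite partition_sum_eq0 // corank_ratio_eq0.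
rewrite corank_ratioS // partition_sumS //; congr (_ * _).
by apply: eq_bigr => c _; rewrite IH.
Qed.

(** * Restriction of scalars *)

Section RestrictionOfScalars.
Variables (F : fieldType) (L : fieldExtType F) (m : nat).
Local Notation n := (m * dim L)%N.

Definition extend_rV (w : 'rV[F]_n) : 'rV[L]_m := \row_i r2v (row i (vec_mx w)).
Definition restrict_rV (v : 'rV[L]_m) : 'rV[F]_n := mxvec (\matrix_i v2r (v 0 i)).

Lemma extend_rVK : cancel extend_rV restrict_rV.
Proof.
move=> w; rewrite /restrict_rV -[RHS]vec_mxK; congr mxvec; apply/row_matrixP => i.
by rewrite rowK mxE r2vK.
Qed.

Lemma restrict_rVK : cancel restrict_rV extend_rV.
Proof. by move=> v; apply/rowP => i; rewrite mxE mxvecK rowK v2rK. Qed.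

Lemma extend_rV_is_zmod_morphism : zmod_morphism extend_rV.
Proof. by move=> u v; apply/rowP => i; rewrite !mxE !linearB. Qed.

HB.instance Definition _ :=
  GRing.isZmodMorphism.Build 'rV[F]_n 'rV[L]_m extend_rV extend_rV_is_zmod_morphism.

Lemma extend_rVZ a u : extend_rV (a *: u) = a%:A *: extend_rV u.
Proof. by apply/rowP => i; rewrite !mxE !linearZ /= mulr_algl. Qed.

Lemma restrict_rV_linear a u v :
  restrict_rV (a%:A *: u + v) = a *: restrict_rV u + restrict_rV v.
Proof.
by apply: (can_inj extend_rVK); rewrite raddfD /= extend_rVZ !restrict_rVK.
Qed.

Definition restrict_mx (N : 'M[L]_m) : 'M[F]_n :=
  lin1_mx (fun w => restrict_rV (extend_rV w *m N)).

Lemma extend_rV_mul w N : extend_rV (w *m restrict_mx N) = extend_rV w *m N.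
Proof.
rewrite mul_rV_lin1_fun ?restrict_rVK // => a u v.
by rewrite raddfD /= extend_rVZ mulmxDl -scalemxAl restrict_rV_linear.
Qed.

Lemma restrict_mx_unique T N :
  (forall w, extend_rV (w *m T) = extend_rV w *m N) -> T = restrict_mx N.
Proof.
move=> TN; apply: eq_mulrV => w; apply: (can_inj extend_rVK).
by rewrite TN extend_rV_mul.
Qed.

Lemma restrict_mx_inj : injective restrict_mx.
Proof.
move=> N N' eqNN'; apply: eq_mulrV => v.
by rewrite -[v]restrict_rVK -!extend_rV_mul eqNN'.
Qed.

Lemma restrict_mx_is_zmod_morphism : zmod_morphism restrict_mx.
Proof.
move=> N N'; apply/esym/restrict_mx_unique => w.
by rewrite mulmxBr raddfB /= !extend_rV_mul mulmxBr.
Qed.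

Lemma restrict_mx_is_monoid_morphism : monoid_morphism restrict_mx.
Proof.
split=> [|N N']; apply/esym/restrict_mx_unique => w; first by rewrite !mulmx1.
by rewrite mulmxA !extend_rV_mul mulmxA.
Qed.

HB.instance Definition _ :=
  GRing.isZmodMorphism.Build 'M[L]_m 'M[F]_n restrict_mx
    restrict_mx_is_zmod_morphism.
HB.instance Definition _ :=
  GRing.isMonoidMorphism.Build 'M[L]_m 'M[F]_n restrict_mx
    restrict_mx_is_monoid_morphism.

Lemma restrict_mx_alg a : restrict_mx a%:A%:M = a%:M.
Proof.
apply/esym/restrict_mx_unique => w; rewrite !mul_mx_scalar.
exact: extend_rVZ.
Qed.

Lemma restrict_mx_commute (P : 'M_n) (x : L) f :
    P *m restrict_mx x%:M = restrict_mx x%:M *m P ->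
  P *m restrict_mx (horner_alg x f)%:M = restrict_mx (horner_alg x f)%:M *m P.
Proof.
move=> Px; have <- : mxeval (restrict_mx x%:M) f = restrict_mx (horner_alg x f)%:M.
  elim/poly_ind: f => [|f c IH]; first by rewrite !rmorph0.
  rewrite !rmorphD !rmorphM /= !mxevalX mxevalC IH horner_algX horner_algC.
  by rewrite restrict_mx_alg.
exact: mxeval_intertwine.
Qed.

Lemma restrict_mx_centralizer (x : L) T :
    (forall y : L, exists f, y = horner_alg x f) ->
    T *m restrict_mx x%:M = restrict_mx x%:M *m T ->
  exists N, T = restrict_mx N.
Proof.
move=> gen_x Tx; pose g (v : 'rV[L]_m) := extend_rV (restrict_rV v *m T).
exists (lin1_mx g); apply: restrict_mx_unique => w.
rewrite mul_rV_lin1_fun /g ?extend_rVK // => y u v.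
have [f yE] := gen_x y.
have restrictZ : restrict_rV (y *: u) = restrict_rV u *m restrict_mx y%:M.
  by apply: (can_inj extend_rVK); rewrite extend_rV_mul !restrict_rVK mul_mx_scalar.
have -> : restrict_rV (y *: u + v) = restrict_rV (y *: u) + restrict_rV v.
  by apply: (can_inj extend_rVK); rewrite raddfD /= !restrict_rVK.
rewrite mulmxDl raddfD /= restrictZ -mulmxA yE -restrict_mx_commute //.
by rewrite mulmxA extend_rV_mul mul_mx_scalar.
Qed.

Lemma mxeval_restrict_mx A f :
  mxeval (restrict_mx A) f = restrict_mx (mxeval A (map_poly (in_alg L) f)).
Proof.
elim/poly_ind: f => [|f c IH]; first by rewrite !rmorph0.
rewrite !rmorphD !rmorphM /= map_polyX map_polyC !mxevalX !mxevalC IH.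
by rewrite restrict_mx_alg.
Qed.

Lemma restrict_mx_unit N : (restrict_mx N \in unitmx) = (N \in unitmx).
Proof.
apply/idP/idP => Nu; rewrite -row_free_unit; apply: inj_row_free => v vN0.
  apply: (can_inj restrict_rVK); apply: (can_inj (mulmxK Nu)).
  apply: (can_inj extend_rVK).
  by rewrite !extend_rV_mul !restrict_rVK vN0 mul0mx.
apply: (can_inj extend_rVK); apply: (can_inj (mulmxK Nu)).
by rewrite -extend_rV_mul vN0 raddf0 mul0mx.
Qed.

Lemma conjmx_restrict_mx T A : T \in unitmx ->
  conjmx (restrict_mx T) (restrict_mx A) = restrict_mx (conjmx T A).
Proof.
move=> Tu; apply/eqP/conjmx_eqP; rewrite ?restrict_mx_unit // !mulmxE -!rmorphM.
by congr restrict_mx; apply/conjmx_eqP.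
Qed.

End RestrictionOfScalars.

Section FiniteModule.
Variables (K : finFieldType) (V : finLmodType K).

Definition lin_comb m (b : {ffun 'I_m -> V}) (w : 'rV[K]_m) : V := \sum_i w 0 i *: b i.

Lemma lin_comb_is_linear m (b : {ffun 'I_m -> V}) : linear (lin_comb b).
Proof.
move=> a u v; rewrite scaler_sumr -big_split; apply: eq_bigr => i _.
by rewrite !mxE scalerDl scalerA.
Qed.

HB.instance Definition _ m (b : {ffun 'I_m -> V}) :=
  GRing.isLinear.Build K 'rV[K]_m V _ (lin_comb b) (lin_comb_is_linear b).

Definition cons_ffun m (u : V) (b : {ffun 'I_m -> V}) : {ffun 'I_m.+1 -> V} :=
  [ffun i => oapp b u (unlift ord0 i)].

Lemma lin_comb_cons_inj m (u : V) (b : {ffun 'I_m -> V}) :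
  injective (lin_comb b) -> (forall w, lin_comb b w != u) ->
  injective (lin_comb (cons_ffun u b)).
Proof.
move=> b_inj not_u; apply: raddf_inj => w /=.
pose w' := \row_j w 0 (lift ord0 j).
have -> : lin_comb (cons_ffun u b) w = w 0 ord0 *: u + lin_comb b w'.
  rewrite [LHS]big_ord_recl ffunE unlift_none; congr (_ + _).
  by apply: eq_bigr => j _; rewrite ffunE liftK mxE.
have [w0|w0_neq0] := eqVneq (w 0 ord0) 0.
  rewrite w0 scale0r add0r -[RHS](raddf0 (lin_comb b)) => /b_inj /rowP w'0.
  apply/rowP => i; rewrite mxE; case: (unliftP ord0 i) => [j ->|->] //.
  by have := w'0 j; rewrite !mxE.
move/eqP; rewrite addr_eq0 => /eqP /(canRL (scalerK w0_neq0)) uE.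
by case/eqP: (not_u ((w 0 ord0)^-1 *: - w')); rewrite uE linearZ linearN.
Qed.

Lemma fin_lmod_basis : exists m (f : {linear 'rV[K]_m -> V}), bijective f.
Proof.
pose P m := [exists b : {ffun 'I_m -> V}, injectiveb (lin_comb b)].
have exP : exists m, P m.
  exists 0%N; apply/existsP; exists [ffun=> 0]; apply/injectiveP => w w' _.
  by rewrite [w]thinmx0 [w']thinmx0.
have ubP m : P m -> (m <= #|V|)%N.
  case/existsP=> b /injectiveP/leq_card; apply: leq_trans.
  by rewrite card_mx mul1n ltnW // ltn_expl // finNzRing_gt1.
case: (ex_maxnP exP ubP) => m /existsP[b /injectiveP b_inj] max_m.
exists m, (lin_comb b); apply: inj_card_bij => //.
rewrite -[leqRHS](card_codom b_inj) subset_leq_card //; apply/subsetP => u _.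
apply: contraT => not_u; suff /max_m : P m.+1 by rewrite ltnn.
apply/existsP; exists (cons_ffun u b); apply/injectiveP/lin_comb_cons_inj => // w.
by apply: contraNneq not_u => <-; apply: codom_f.
Qed.

End FiniteModule.

Section RowModule.
Variables (F K : finFieldType) (n : nat).

(* ['rV[F]_n] with [k : K] acting as right multiplication by [h k]. *)
Definition row_module (h : {rmorphism K -> 'M[F]_n}) := 'rV[F]_n.

Variable h : {rmorphism K -> 'M[F]_n}.

HB.instance Definition _ := FinRing.Zmodule.on (row_module h).

Let scale (k : K) (v : row_module h) : row_module h := v *m h k.

Lemma row_module_scaleA k k' v : scale k (scale k' v) = scale (k * k') v.
Proof. by rewrite /scale -mulmxA mulmxE -rmorphM mulrC. Qed.

Lemma row_module_scale1 : left_id 1 scale.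
Proof. by move=> v; rewrite /scale rmorph1 mulmx1. Qed.

Lemma row_module_scaleDr : right_distributive scale +%R.
Proof. by move=> k u v; rewrite /scale mulmxDl. Qed.

Lemma row_module_scaleDl v : {morph scale^~ v : k k' / k + k'}.
Proof. by move=> k k'; rewrite /scale rmorphD mulmxDr. Qed.

HB.instance Definition _ := GRing.Zmodule_isLmodule.Build K (row_module h)
  row_module_scaleA row_module_scale1 row_module_scaleDr row_module_scaleDl.

Lemma row_module_scaleE k (v : row_module h) : k *: v = v *m h k.
Proof. by []. Qed.

Lemma card_row_module : exists m, (#|F| ^ n = #|K| ^ m)%N.
Proof.
have [m [f f_bij]] := fin_lmod_basis (row_module h).
by exists m; have := bij_eq_card f_bij; rewrite !card_mx !mul1n => ->.
Qed.

End RowModule.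

Lemma row_module_conjugate (F K : finFieldType) n (h1 h2 : {rmorphism K -> 'M[F]_n})
    (c : F -> K) :
  (forall a, h1 (c a) = a%:M) -> (forall a, h2 (c a) = a%:M) ->
  exists2 P, P \in unitmx & forall k, P *m h1 k = h2 k *m P.
Proof.
have [m1 [f1 [g1 f1K g1K]]] := fin_lmod_basis (row_module h1).
have [m2 [f2 [g2 f2K g2K]]] := fin_lmod_basis (row_module h2).
have m12 : m1 = m2.
  have := bij_eq_card (Bijective g1K f1K); rewrite (bij_eq_card (Bijective g2K f2K)).
  rewrite !card_mx !mul1n => /eqP; rewrite eqn_exp2l ?finNzRing_gt1 //.
  by move/eqP.
case: m2 / m12 f2 g2 f2K g2K => f2 g2 f2K g2K h1c h2c.
have g2_lin : linear g2 := can2_linear f2K g2K.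
have PE v : v *m lin1_mx (f1 \o g2) = f1 (g2 v).
  apply: mul_rV_lin1_fun => a u w /=; rewrite -!mul_mx_scalar -{1}h2c.
  by rewrite -row_module_scaleE g2_lin linearP /= -h1c.
exists (lin1_mx (f1 \o g2)).
  rewrite -row_free_unit; apply: inj_row_free => v.
  rewrite PE -[RHS](raddf0 f1) => /(can_inj f1K) g2v0.
  by rewrite -[v]g2K g2v0 raddf0.
move=> k; apply: eq_mulrV => v.
rewrite !mulmxA !PE -!row_module_scaleE.
by rewrite (GRing.semilinear_linear g2_lin).1 linearZ.
Qed.

(** * Powers of an irreducible polynomial *)

Lemma card_pchar_nat (F : finFieldType) k : [pchar F].-nat (#|F| ^ k)%N.
Proof.
have [p _ pF] := finPcharP F; rewrite pnatX; apply/orP; left.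
have : p.-nat #|[set: F]| := pprimeChar_pgroup pF; rewrite cardsT.
by apply: sub_in_pnat => r _ /eqP ->.
Qed.

Lemma expf_cardX (F : finFieldType) (a : F) k : a ^+ (#|F| ^ k) = a.
Proof. by elim: k => [|k IH]; rewrite ?expr1 // expnS exprM expf_card. Qed.

Lemma poly_expf_cardX (F : finFieldType) (g : {poly F}) k :
  g ^+ (#|F| ^ k) = g \Po 'X^(#|F| ^ k).
Proof.
elim/poly_ind: g => [|g c IH].
  by rewrite comp_poly0 expr0n expn_eq0 eqn0Ngt (ltn_trans _ (finNzRing_gt1 F)).
rewrite comp_poly_MXaddC exprDn_pchar; last first.
  by rewrite (eq_pnat _ (pchar_poly F)) card_pchar_nat.
by rewrite exprMn IH -rmorphXn /= expf_cardX.
Qed.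

(* Hence whatever commutes with [a + N] commutes with its semisimple part [a]. *)
Lemma scalarD_nilpotent_expr (K : finFieldType) m (a : K) (N : 'M[K]_m) s k :
  N ^+ s = 0 -> (s <= #|K| ^ k)%N -> (a%:M + N) ^+ (#|K| ^ k) = a%:M.
Proof.
move=> N0 sk; set A := a%:M + N.
have NA : N = mxeval A ('X - a%:P).
  by rewrite rmorphB /= mxevalX mxevalC /A addrAC subrr add0r.
have : N ^+ (#|K| ^ k) = 0 by rewrite -(subnKC sk) exprD N0 mul0r.
rewrite NA -rmorphXn /= poly_expf_cardX rmorphB /= comp_polyX comp_polyC.
by rewrite rmorphB /= mxevalXn mxevalC => /eqP; rewrite subr_eq0 => /eqP.
Qed.

Lemma mord_eq q d e :
    (0 < d)%N -> (0 < e)%N -> q ^ e = 1 %[mod d] ->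
    (forall k, (0 < k)%N -> q ^ k = 1 %[mod d] -> (e <= k)%N) ->
  mord q d = e.
Proof.
move=> d0 e0 qe min_e; have le_ed : (e <= d)%N.
  have cop : coprime q d.
    by rewrite -(coprime_pexpl _ _ e0) -coprime_modl qe coprime_modl coprime1n.
  have tot0 : (0 < totient d)%N by rewrite totient_gt0.
  apply: leq_trans (min_e (totient d) tot0 (Euler_exp_totient cop)) _.
  rewrite totient_count_coprime big_mkord -[leqRHS]card_ord -sum1_card.
  by apply: leq_sum => i _; apply: leq_b1.
rewrite /mord; have -> : iota 1 d = iota 1 e.-1 ++ e :: iota e.+1 (d - e).
  rewrite -[e :: _]/(iota e (d - e).+1) -{2}(prednK e0) -[e.-1.+1]add1n -iotaD.
  by congr iota; lia.
rewrite filter_cat (eq_in_filter (a2 := pred0)) ?filter_pred0 /= ?qe ?eqxx //.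
move=> k; rewrite mem_iota => k_bd; apply/eqP => /min_e; lia.
Qed.

Section SimpleExtension.
Variables (F : finFieldType) (L : fieldExtType F).
Local Notation K := (finvect_type L).
Variables (x : K) (phi : {poly F}).
Hypothesis x_gen : forall y : K, exists f, horner_alg x f == y.
Hypothesis x_minpoly : forall f, (horner_alg x f == 0) = (phi %| f).

Definition polyrep (y : K) : {poly F} := xchoose (x_gen y).

Lemma horner_alg_polyrep y : horner_alg x (polyrep y) = y.
Proof. exact/eqP/(xchooseP (x_gen y)). Qed.

Lemma card_fieldExt : #|K| = (#|F| ^ dim K)%N.
Proof.
rewrite -[dim K in RHS]mul1n -card_mx.
exact: (bij_eq_card (Bijective (v2rK : cancel (v2r : K -> 'rV[F]_(dim K)) _) r2vK)).
Qed.

Section Action.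
Variables (n : nat) (S : 'M[F]_n).
Hypothesis phiS : mxeval S phi = 0.

(* The proof argument is what the canonical morphism structure below hangs on. *)
Definition ext_action of mxeval S phi = 0 := fun y : K => mxeval S (polyrep y).
Local Notation action := (ext_action phiS).

Lemma ext_actionE f : action (horner_alg x f) = mxeval S f.
Proof.
set y := horner_alg _ _; apply/eqP; rewrite -subr_eq0 -rmorphB.
have /dvdpP[g ->] : phi %| polyrep y - f.
  by rewrite -x_minpoly rmorphB /= horner_alg_polyrep subrr.
by rewrite rmorphM /= phiS mulr0.
Qed.

Lemma ext_action_is_zmod_morphism : zmod_morphism action.
Proof.
move=> y z; rewrite -[y]horner_alg_polyrep -[z]horner_alg_polyrep.
by rewrite -rmorphB !ext_actionE rmorphB.
Qed.

Lemma ext_action_is_monoid_morphism : monoid_morphism action.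
Proof.
split=> [|y z]; first by rewrite -(rmorph1 (horner_alg x)) ext_actionE rmorph1.
rewrite -[y]horner_alg_polyrep -[z]horner_alg_polyrep.
by rewrite -rmorphM !ext_actionE rmorphM.
Qed.

HB.instance Definition _ :=
  GRing.isZmodMorphism.Build K 'M[F]_n action ext_action_is_zmod_morphism.
HB.instance Definition _ :=
  GRing.isMonoidMorphism.Build K 'M[F]_n action ext_action_is_monoid_morphism.

Lemma dim_dvdn : (dim K %| n)%N.
Proof.
have [m /eqP] := card_row_module action.
rewrite card_fieldExt -expnM eqn_exp2l ?finNzRing_gt1 // => /eqP->.
exact: dvdn_mulr.
Qed.

End Action.

Lemma similar_restrict_mx m (S : 'M[F]_(m * dim K)) : mxeval S phi = 0 ->
  exists2 P, P \in unitmx & conjmx P S = restrict_mx (x%:M : 'M[K]_m).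
Proof.
move=> phiS.
have [||P Pu PS] := row_module_conjugate (c := fun a => a%:A) (h1 := ext_action phiS)
    (h2 := @restrict_mx F K m \o scalar_mx).
- by move=> a /=; rewrite -(horner_algC x) ext_actionE mxevalC.
- exact: restrict_mx_alg.
exists P => //; apply/eqP/conjmx_eqP => //; have := PS (horner_alg x 'X).
by rewrite /= ext_actionE mxevalX horner_algX.
Qed.

Lemma restrict_mx_gen_centralizer m (T : 'M[F]_(m * dim K)) :
    T *m restrict_mx x%:M = restrict_mx x%:M *m T ->
  exists N : 'M[K]_m, T = restrict_mx N.
Proof.
apply: restrict_mx_centralizer => y.
by exists (polyrep y); rewrite horner_alg_polyrep.
Qed.

Lemma mxeval_restrict_scalarD m (N : 'M[K]_m) s : N ^+ s = 0 ->
  mxeval (restrict_mx (x%:M + N)) (phi ^+ s) = 0.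
Proof.
move=> N0; rewrite mxeval_restrict_mx rmorphXn /=.
have /factor_theorem[g ->] : root (map_poly (in_alg K) phi) x.
  by rewrite /root [_.[_]]/(horner_alg x phi) x_minpoly.
rewrite exprMn rmorphM /= !rmorphXn rmorphB /= mxevalX mxevalC addrAC subrr add0r.
by rewrite N0 mulr0 rmorph0.
Qed.

Lemma jordan_chevalley n (A : 'M[F]_n) s : mxeval A (phi ^+ s) = 0 ->
  exists S N, [/\ A = S + N, mxeval S phi = 0, N ^+ s = 0 & S *m N = N *m S].
Proof.
move=> A0; pose k := (#|K| ^ s)%N.
have kE : k = (#|F| ^ (dim K * s))%N by rewrite /k card_fieldExt expnM.
have sk : (s <= k)%N by rewrite ltnW // ltn_expl // finNzRing_gt1.
exists (mxeval A 'X^k), (mxeval A ('X - 'X^k)).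
have /dvdpP[g gE] : phi %| 'X - 'X^k.
  rewrite -x_minpoly rmorphB rmorphXn /= horner_algX subr_eq0.
  exact/eqP/esym/(expf_cardX x).
split.
- by rewrite -rmorphD -[LHS]mxevalX; congr mxeval; rewrite addrC subrK.
- rewrite -mxeval_comp kE -poly_expf_cardX -kE -(subnKC sk) exprD rmorphM /= A0.
  by rewrite mul0r.
- by rewrite gE -rmorphXn /= exprMn rmorphM /= A0 mulr0.
- by rewrite !mulmxE -!rmorphM mulrC.
Qed.

Section JordanModels.
Variables m s : nat.

Definition jordan_models :=
  [set restrict_mx (x%:M + N : 'M[K]_m) | N : 'M[K]_m in mxroots 'X^s m].

Definition restricted_units := [set restrict_mx T | T : 'M[K]_m in GLset K m].

Lemma jordan_model_mxroot A :
  (A \in mxroots (phi ^+ s) (m * dim K)) <->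
  exists2 P, P \in unitmx & conjmx P A \in jordan_models.
Proof.
split=> [|[P Pu /imsetP[N]]]; last first.
  rewrite mem_mxroots_Xn => /eqP N0 PA; rewrite -(mxroots_conjmx _ _ Pu) PA inE.
  by rewrite mxeval_restrict_scalarD.
rewrite inE => /eqP /jordan_chevalley[S [N [-> phiS N0 SN]]].
have [P Pu PS] := similar_restrict_mx phiS; exists P => //.
have [N' PN] : exists N', conjmx P N = restrict_mx N'.
  apply: restrict_mx_gen_centralizer; rewrite -PS -!conjmxM ?inE ?stablemx_unit //.
  by rewrite SN.
apply/imsetP; exists N'.
  rewrite mem_mxroots_Xn -(inj_eq (@restrict_mx_inj F K m)) rmorphXn rmorph0 /= -PN.
  by rewrite -mem_mxroots_Xn mxroots_conjmx // mem_mxroots_Xn N0.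
by rewrite rmorphD /= -PN -PS /conjmx mulmxDr mulmxDl.
Qed.

Lemma jordan_models_transporter P A :
    P \in unitmx -> A \in jordan_models ->
  (conjmx P A \in jordan_models) = (P \in restricted_units).
Proof.
move=> Pu /imsetP[N]; rewrite mem_mxroots_Xn => /eqP N0 ->.
apply/imsetP/imsetP => [[N' + /eqP/(conjmx_eqP _ _ Pu) PA]|[T + ->]]; last first.
  rewrite inE => Tu; exists (conjmx T N).
    by rewrite mxroots_conjmx // mem_mxroots_Xn N0.
  rewrite conjmx_restrict_mx // /conjmx mulmxDr mulmxDl -/(conjmx T x%:M).
  by rewrite conjmx_scalar ?row_free_unit.
rewrite mem_mxroots_Xn => /eqP N0'.
have sk : (s <= #|K| ^ s)%N by rewrite ltnW // ltn_expl // finNzRing_gt1.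
have [T TE] : exists T : 'M[K]_m, P = restrict_mx T.
  apply: restrict_mx_gen_centralizer; have := mxeval_intertwine 'X^(#|K| ^ s) PA.
  by rewrite !mxevalXn -!rmorphXn /= !(scalarD_nilpotent_expr _ _ sk).
by exists T => //; rewrite inE -restrict_mx_unit -TE.
Qed.

Lemma card_mxroots_irreducible_power :
  (#|mxroots (phi ^+ s) (m * dim K)| * GLcard K m =
   GLcard F (m * dim K) * #|mxroots ('X^s : {poly K}) m|)%N.
Proof.
rewrite -[GLcard K m](card_imset _ (@restrict_mx_inj F K m)).
pose model (N : 'M[K]_m) := restrict_mx (x%:M + N).
rewrite -[#|mxroots 'X^s m|](card_imset _ (f := model)); last first.
  by move=> N N' /restrict_mx_inj/addrI.
apply: card_similarity_closure jordan_models_transporter.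
  exact: jordan_model_mxroot.
by move=> _ /imsetP[T + ->]; rewrite inE restrict_mx_unit.
Qed.

End JordanModels.

Lemma mxroot_ps_simple_extension s n :
  mxroot_ps (phi ^+ s) n = factor_ps #|F| (dim K) s n.
Proof.
have dim_gt0 : (0 < dim K)%N by rewrite -dimvf adim_gt0.
have [/dvdnP[m ->]|ndv] := boolP (dim K %| n)%N.
  rewrite -(mxroot_ps_Xn _ _ dim_gt0 card_fieldExt).
  apply/eqP; rewrite eqr_div ?GLcard_neq0 // -!natrM.
  by rewrite card_mxroots_irreducible_power mulnC.
have n0 : n != 0%N by apply: contraNneq ndv => ->; apply: dvdn0.
rewrite /factor_ps (negPf n0) (negPf ndv) /mxroot_ps eq_card0 ?mul0r // => A.
rewrite !inE; apply: contraNF ndv => /eqP/jordan_chevalley[S [N [_ phiS _ _]]].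
exact: dim_dvdn phiS.
Qed.

Lemma leq_dim_fixed_generator k :
  (0 < k)%N -> x ^+ (#|F| ^ k) = x -> (dim K <= k)%N.
Proof.
move=> k0 xk; have fixed (y : K) : y ^+ (#|F| ^ k) = y.
  rewrite -[y]horner_alg_polyrep -rmorphXn poly_expf_cardX /=.
  elim/poly_ind: (polyrep y) => [|f c IH]; first by rewrite comp_poly0.
  by rewrite comp_poly_MXaddC !rmorphD !rmorphM /= IH rmorphXn /= horner_algX xk.
have q1 : (1 < #|F|)%N := finNzRing_gt1 F.
have qk1 : (1 < #|F| ^ k)%N by rewrite -(expn0 #|F|) ltn_exp2l.
have size_XqX : size ('X^(#|F| ^ k) - 'X : {poly K}) = (#|F| ^ k).+1.
  by rewrite size_polyDl size_polyXn // size_polyN size_polyX ltnS.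
rewrite -(leq_exp2l _ _ q1) -card_fieldExt cardE -ltnS -size_XqX.
apply: max_poly_roots; rewrite ?enum_uniq -?size_poly_gt0 ?size_XqX //.
by apply/allP => y _; rewrite rootE !hornerE fixed subrr.
Qed.

Lemma mord_simple_extension d : d.-primitive_root x -> mord #|F| d = dim K.
Proof.
move=> prim_x; have modE k : (#|F| ^ k == 1 %[mod d]) = (x ^+ (#|F| ^ k) == x).
  by rewrite -(eq_prim_root_expr prim_x) expr1.
apply: mord_eq; first exact: prim_order_gt0 prim_x.
- by rewrite -dimvf adim_gt0.
- by apply/eqP; rewrite modE -card_fieldExt expf_card.
- by move=> k k0 /eqP; rewrite modE => /eqP; apply: leq_dim_fixed_generator.
Qed.

End SimpleExtension.

Lemma simple_extension_exists (F : finFieldType) (phi : {poly F}) :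
    monic_irreducible_poly phi ->
  exists (L : fieldExtType F) (x : finvect_type L),
    [/\ forall y, exists f, horner_alg x f == y,
        forall f, (horner_alg x f == 0) = (phi %| f) &
        dim (finvect_type L) = (size phi).-1].
Proof.
move=> mi; pose L : fieldExtType F := {poly %/ phi with mi}.
pose x : finvect_type L := in_qpoly phi 'X.
have horner_alg_x f : horner_alg x f = in_qpoly phi f.
  exact/esym/(poly_alg_initial (in_qpoly phi : {lrmorphism {poly F} -> {poly %/ phi}})).
exists L, x; split=> [y|f|].
- exists ((y : {poly %/ phi}) : {poly F}); rewrite horner_alg_x; apply/eqP/val_inj.
  exact/in_qpoly_small/size_mk_monic.
- rewrite horner_alg_x -val_eqE /= (mk_monicE mi) /dvdp.
  by rewrite (Pdiv.IdomainMonic.modpE mi.2).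
- by rewrite -[dim _]/(size (mk_monic phi)).-1 (mk_monicE mi).
Qed.

Theorem mxroot_ps_irreducible_power (F : finFieldType) (phi : {poly F}) s n :
    monic_irreducible_poly phi ->
  mxroot_ps (phi ^+ s) n = factor_ps #|F| (size phi).-1 s n.
Proof.
case/simple_extension_exists=> L [x [x_gen x_min <-]].
exact: (mxroot_ps_simple_extension x_gen x_min).
Qed.

(** * Cyclotomic polynomials *)

Lemma size_monic_prod (R : idomainType) (fs : seq {poly R}) :
  {in fs, forall f, f \is monic} ->
  (size (\prod_(f <- fs) f)).-1 = (\sum_(f <- fs) (size f).-1)%N.
Proof.
elim: fs => [|f fs IH] mon; first by rewrite !big_nil size_poly1.
have mon_f : f \is monic by rewrite mon ?mem_head.
have mon_fs : {in fs, forall g, g \is monic}.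
  by move=> g gfs; rewrite mon // inE gfs orbT.
rewrite !big_cons -IH // size_Mmonic ?monic_neq0 //; last first.
  by rewrite big_seq monic_prod.
have : (0 < size f)%N by rewrite size_poly_gt0 monic_neq0.
have : (0 < size (\prod_(g <- fs) g)%R)%N.
  by rewrite size_poly_gt0 monic_neq0 // big_seq monic_prod.
lia.
Qed.

Lemma coprimep_separable_prod (R : fieldType) (I : eqType) (s : seq I)
    (G : I -> {poly R}) i j :
  separable_poly (\prod_(i <- s) G i) -> i \in s -> j \in s -> i != j ->
  coprimep (G i) (G j).
Proof.
move=> sep si sj ij; move: sep; rewrite (big_rem i) //= separable_mul.
case/and3P=> _ _; rewrite (big_rem j) /= ?coprimepMr; first by case/andP.
by apply: rem_mem; rewrite // eq_sym.
Qed.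

Section Factorization.
Variable F : finFieldType.
Implicit Types f g : {poly F}.

Lemma monic_proper_divisor g : (1 < size g)%N -> ~~ irreducibleb g ->
  exists f, [/\ f \is monic, f %| g & (1 < size f < size g)%N].
Proof.
move=> s1; rewrite /irreducibleb s1 /= => /forallPn[f].
rewrite -dvdpE negb_imply -ltnNge => /andP[fg s1f].
have f_neq0 : (f : {poly F}) != 0 by rewrite -size_poly_gt0 ltnW.
have c_neq0 : (lead_coef f)^-1 != 0 by rewrite invr_eq0 lead_coef_eq0.
exists ((lead_coef f)^-1 *: (f : {poly F})); rewrite dvdpZl // size_scale // s1f.
rewrite monicE lead_coefZ mulVf ?lead_coef_eq0 //; split=> //.
by rewrite -[X in (_ < X)%N](prednK (ltnW s1)) ltnS size_npoly.
Qed.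

Lemma monic_irreducible_factorization g : g \is monic ->
  exists2 fs : seq {poly F},
    {in fs, forall f, monic_irreducible_poly f} & g = \prod_(f <- fs) f.
Proof.
have [n] := ubnP (size g); elim: n g => // n IH g; rewrite ltnS => le_gn mon_g.
have [s1|s1] := leqP (size g) 1.
  exists [::] => //; rewrite big_nil.
  by move: mon_g; rewrite (size1_polyC s1) monicE lead_coefC => /eqP->.
have [/irreducibleP irr|] := boolP (irreducibleb g).
  by exists [:: g] => [f|]; rewrite ?big_seq1 // inE => /eqP->.
case/(monic_proper_divisor s1) => f [mon_f fg /andP[s1f lt_fg]].
have [h gE] : exists h : {poly F}, g = h * f by apply/dvdpP.
have mon_h : h \is monic by rewrite -(monicMr _ mon_f) -gE.
have lt_hg : (size h < size g)%N.
  have : (0 < size h)%N by rewrite size_poly_gt0 monic_neq0.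
  rewrite gE size_Mmonic ?monic_neq0 //; lia.
rewrite {}gE mulrC.
have [fs irr_fs ->] := IH f (leq_trans lt_fg le_gn) mon_f.
have [hs irr_hs ->] := IH h (leq_trans lt_hg le_gn) mon_h.
exists (fs ++ hs); last by rewrite big_cat.
by move=> k; rewrite mem_cat => /orP[/irr_fs|/irr_hs].
Qed.

End Factorization.

Lemma eq_ps_prod (I : eqType) (s : seq I) (f g : I -> ps) n :
  {in s, forall i, f i =1 g i} ->
  ps_prod [seq f i | i <- s] n = ps_prod [seq g i | i <- s] n.
Proof.
elim: s n => //= i s IH n fg; apply: eq_bigr => j _.
by rewrite fg ?mem_head // IH // => k ks; apply: fg; rewrite inE ks orbT.
Qed.

Lemma ps_prod_const (I : Type) (s : seq I) (f : ps) :
  ps_prod [seq f | _ <- s] = ps_pow f (size s).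
Proof. by elim: s => //= i s ->. Qed.

Lemma mxroot_ps_equal_degree (F : finFieldType) (g : {poly F}) e s n :
    g \is monic -> separable_poly g ->
    (forall f, monic_irreducible_poly f -> f %| g -> (size f).-1 = e) ->
  mxroot_ps (g ^+ s) n = ps_pow (factor_ps #|F| e s) ((size g).-1 %/ e) n.
Proof.
move=> mon_g; have [fs irr_fs -> sep deg] := monic_irreducible_factorization mon_g.
have deg_fs f : f \in fs -> (size f).-1 = e.
  by move=> ffs; apply: deg (irr_fs f ffs) _; rewrite (big_rem f) //= dvdp_mulr.
rewrite mxroot_ps_prod // size_monic_prod; last by move=> f /irr_fs[].
have -> : ((\sum_(f <- fs) (size f).-1) %/ e = size fs)%N.
  rewrite (eq_big_seq _ deg_fs) big_const_seq count_predT iter_addn_0.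
  case: fs irr_fs deg_fs {sep deg} => [|f fs] irr_fs deg_fs.
    by rewrite muln0 div0n.
  rewrite mulKn // -(deg_fs f) ?mem_head //.
  by have := (irr_fs f (mem_head _ _)).1.1; case: (size f) => [|[]].
rewrite -ps_prod_const; apply: eq_ps_prod => f ffs k.
by rewrite mxroot_ps_irreducible_power ?deg_fs //; apply: irr_fs.
Qed.

Section CyclotomicFactors.

Definition cyclotomic_over (R : nzRingType) d : {poly R} := map_poly intr 'Phi_d.

Lemma prod_cyclotomic_over (R : nzRingType) d :
  (0 < d)%N -> \prod_(j <- divisors d) cyclotomic_over R j = 'X^d - 1.
Proof.
move=> d0; have := congr1 (map_poly (intr : int -> R)) (prod_Cyclotomic d0).
by rewrite rmorph_prod /= rmorphB /= map_polyXn rmorph1.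
Qed.

Lemma cyclotomic_over_monic (R : nzRingType) d : cyclotomic_over R d \is monic.
Proof. by rewrite monic_map ?Cyclotomic_monic. Qed.

Lemma size_cyclotomic_over (R : nzRingType) d :
  size (cyclotomic_over R d) = (totient d).+1.
Proof.
rewrite -size_Cyclotomic size_map_poly_id0 //.
by rewrite (monicP (Cyclotomic_monic d)) rmorph1 oner_eq0.
Qed.

Lemma root_Xn_sub1_cyclotomic_over (K : fieldType) (x : K) d : (0 < d)%N ->
  root ('X^d - 1) x = has (fun j => root (cyclotomic_over K j) x) (divisors d).
Proof.
by move=> d0; rewrite -prod_cyclotomic_over // rootE horner_prod prodf_seq_eq0.
Qed.

Lemma cyclotomic_over_primitive_root (K : fieldType) (x : K) d :
  d%:R != 0 :> K -> root (cyclotomic_over K d) x -> d.-primitive_root x.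
Proof.
move=> d_neq0 Phi_x; have d0 : (0 < d)%N by case: d d_neq0 {Phi_x} => //; rewrite eqxx.
have dd : d \in divisors d by rewrite -dvdn_divisors.
have /(prim_order_exists d0)[m prim_x md] : x ^+ d = 1.
  apply/eqP; rewrite -subr_eq0; have : root ('X^d - 1) x.
    by rewrite root_Xn_sub1_cyclotomic_over //; apply/hasP; exists d.
  by rewrite rootE !hornerE.
have m0 := prim_order_gt0 prim_x.
have /hasP[j jm Phi_j] : has (fun j => root (cyclotomic_over K j) x) (divisors m).
  rewrite -root_Xn_sub1_cyclotomic_over // rootE !hornerE.
  by rewrite (prim_expr_order prim_x) subrr.
move: jm; rewrite -dvdn_divisors // => jm.
have [dj|neq_dj] := eqVneq d j.
  by rewrite (_ : d = m) //; apply/eqP; rewrite eqn_dvd md dj jm.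
have jd : j \in divisors d by rewrite -dvdn_divisors // (dvdn_trans jm).
have sep : separable_poly (\prod_(i <- divisors d) cyclotomic_over K i).
  by rewrite prod_cyclotomic_over // separable_Xn_sub_1.
have /coprimep_root/(_ Phi_x) :=
  coprimep_separable_prod (G := cyclotomic_over K) sep dd jd neq_dj.
by rewrite -/(root _ x) Phi_j.
Qed.

Variable F : finFieldType.

Lemma size_irreducible_factor_cyclotomic (f : {poly F}) d :
    d%:R != 0 :> F -> monic_irreducible_poly f -> f %| cyclotomic_over F d ->
  (size f).-1 = mord #|F| d.
Proof.
move=> d_neq0 /simple_extension_exists[L [x [x_gen x_min <-]]] f_dvd.
apply/esym/(mord_simple_extension x_gen)/cyclotomic_over_primitive_root.
  by rewrite -(rmorph_nat (in_alg _)) fmorph_eq0.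
have : horner_alg x (cyclotomic_over F d) == 0 by rewrite x_min.
rewrite /horner_alg /horner_morph /cyclotomic_over -map_poly_comp.
by rewrite (eq_map_poly (g := intr)) // => z; apply: rmorph_int.
Qed.

Lemma mxroot_ps_cyclotomic_over d s n : d%:R != 0 :> F ->
  mxroot_ps (cyclotomic_over F d ^+ s) n =
  ps_pow (factor_ps #|F| (mord #|F| d) s) (totient d %/ mord #|F| d) n.
Proof.
move=> d_neq0; have d0 : (0 < d)%N by case: d d_neq0 => //; rewrite eqxx.
rewrite (@mxroot_ps_equal_degree _ _ (mord #|F| d)) ?cyclotomic_over_monic //.
- by rewrite size_cyclotomic_over.
- have := separable_Xn_sub_1 d_neq0; rewrite -prod_cyclotomic_over //.
  by rewrite (big_rem d) -?dvdn_divisors //= separable_mul => /andP[].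
- by move=> f; apply: size_irreducible_factor_cyclotomic.
Qed.

End CyclotomicFactors.

Lemma mxroots_Xn_sub1 (F : finFieldType) M n : (0 < M)%N ->
  mxroots ('X^M - 1 : {poly F}) n = [set A : 'M[F]_n in GLset F n | A ^+ M == 1].
Proof.
move=> M0; apply/setP => A; rewrite !inE rmorphB rmorph1 /= mxevalXn subr_eq0.
apply/eqP/andP => [AM|[_ /eqP] //]; split; last exact/eqP.
have : A *m A ^+ M.-1 = 1%:M by rewrite mulmxE -exprS prednK.
by case/mulmx1_unit.
Qed.

Lemma lhs_psE (F : finFieldType) M n :
  (0 < M)%N -> lhs_ps F M n = mxroot_ps ('X^M - 1 : {poly F}) n.
Proof.
move=> M0; rewrite /lhs_ps; case: eqP => [->|_]; first by rewrite mxroot_ps0.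
rewrite /mxroot_ps mxroots_Xn_sub1 //; congr (_%:R / _).
by apply: eq_card => A; rewrite !inE.
Qed.

Lemma Xn_sub1_pchar_exp (F : finFieldType) p t r : p \in [pchar F] ->
  'X^(t * p ^ r) - 1 = ('X^t - 1) ^+ (p ^ r) :> {poly F}.
Proof.
move=> pF; have pn : [pchar {poly F}].-nat (p ^ r)%N.
  rewrite (eq_pnat _ (pchar_poly F)) (eq_pnat _ (pcharf_eq pF)).
  by rewrite pnatX pnat_id // (pcharf_prime pF).
by rewrite exprDn_pchar // exprNn_pchar // expr1n -exprM.
Qed.

Theorem mainTheorem8 (p k : nat) (F : finFieldType) (M t r : nat) :
  prime p -> odd p -> (0 < k)%N -> #|F| = (p ^ k)%N ->
  (2 <= M)%N -> M = (t * p ^ r)%N -> ~~ (p %| t)%N ->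
  forall n : nat, lhs_ps F M n = rhs_ps (p ^ k) t (p ^ r) n.
Proof.
move=> p_pr _ _ cardF M2 ME p_ndvd_t n.
have pF : p \in [pchar F] := card_finPcharP cardF p_pr.
have t0 : (0 < t)%N by case: t p_ndvd_t {ME} => //; rewrite dvdn0.
have dvd_neq0 d : (d %| t)%N -> d%:R != 0 :> F.
  move=> dt; rewrite -(dvdn_pcharf pF); apply: contra p_ndvd_t => pd.
  exact: dvdn_trans pd dt.
rewrite lhs_psE ?(ltnW M2) // ME Xn_sub1_pchar_exp // -prod_cyclotomic_over //.
rewrite mxroot_ps_prod; last first.
  by rewrite prod_cyclotomic_over // separable_Xn_sub_1 ?dvd_neq0.
apply: eq_ps_prod => d; rewrite -dvdn_divisors // => dt m.
by rewrite mxroot_ps_cyclotomic_over ?dvd_neq0 // cardF.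
Qed.
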